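(* Let $\alpha>0$, $c_0>0$, $d>0$, and let $\Gamma\subset\mathbb{R}^2$ be a compact planar curve parameterized by a $C^{n,\alpha}$ map $\gamma=(\gamma_1,\gamma_2):[0,1]\to\mathbb{R}^2$. Suppose there is a collection $\mathcal{M}=\{m_1,\dots,m_n\}$ of distinct monomials in two variables, including $x$ and $y$, such that $W^{\mathcal{M}}(\Gamma)(t)>c_0$ for all $t\in[0,1]$. Then for every $\epsilon>0$ and every positive integer $N$, \[|\mathcal{N}_{d/N^n}(\Gamma)\cap(\tfrac1N\mathbb{Z})^2|\le C\,N^{e(\mathcal{M})+\epsilon},\qquad e(\mathcal{M})=\frac{2}{n(n+1)}\sum_{i=1}^n\deg m_i,\] where $C$ depends on $\epsilon$, $\|\gamma\|_{C^{n,\alpha}}$, $c_0$ and $d$.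
   Context: $C^{n,\alpha}$ means $n$ times continuously differentiable with $\alpha$-Hölder continuous $n$-th derivative. Writing $m_i(t)=m_i(\gamma_1(t),\gamma_2(t))$, define $W^{\mathcal{M}}(\Gamma)(t)=\det\big(m_j^{(i)}(t)\big)_{1\le i,j\le n}$ (row $i$ contains the $i$-th derivatives of $m_1(t),\dots,m_n(t)$). $\mathcal{N}_\delta(\Gamma)$ is the $\delta$-neighborhood of $\Gamma$. *)

(* Defs.v *)
From HB Require Import structures.
From mathcomp Require Import all_boot all_order all_algebra.
From mathcomp Require Import finmap.
From mathcomp Require Import all_classical all_reals all_analysis.

Set Implicit Arguments.
Unset Strict Implicit.
Unset Printing Implicit Defensive.

Import Order.TTheory GRing.Theory Num.Theory.
Import numFieldNormedType.Exports.

Local Open Scope classical_set_scope.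
Local Open Scope ring_scope.

Section Defs.
Context {R : realType}.
Implicit Types (f : R -> R) (gamma : R -> R * R) (t : R).

(* The library's norm and balls on [R * R] are those of the sup norm. *)
Definition enorm (p : R * R) : R := Num.sqrt (p.1 ^+ 2 + p.2 ^+ 2).

(* Derivatives are taken within [0, 1]: one-sided at the endpoints, and
   independent of the values of the function outside [0, 1]. *)
Definition diffquot f t : R -> R := fun y => (f y - f t) / (y - t).

Definition derivable01 f t : Prop :=
  cvg (diffquot f t y @[y --> within `[0, 1] t^']).

Definition derive01 f : R -> R :=
  fun t => lim (diffquot f t y @[y --> within `[0, 1] t^']).

Definition derive01n (k : nat) f : R -> R := iter k derive01 f.

Definition cderive01n (k : nat) gamma : R -> R * R :=
  fun t => (derive01n k (fst \o gamma) t, derive01n k (snd \o gamma) t).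

(* Continuity of the derivatives of order < n follows from differentiability,
   that of the n-th one from the Hoelder condition (for alpha > 0). *)
Definition CnHoelder (n : nat) (alpha : R) gamma : Prop :=
  (forall (k : nat) (t : R), (k < n)%N -> t \in `[0, 1] ->
     derivable01 (derive01n k (fst \o gamma)) t /\
     derivable01 (derive01n k (snd \o gamma)) t) /\
  (exists K : R, forall s t : R, s \in `[0, 1] -> t \in `[0, 1] ->
     enorm (cderive01n n gamma s - cderive01n n gamma t)
       <= K * `|s - t| `^ alpha).

Definition hoelder_seminorm (alpha : R) gamma : R :=
  sup [set r | exists s t : R, [/\ s \in `[0, 1], t \in `[0, 1], s != t &
         r = enorm (gamma s - gamma t) / `|s - t| `^ alpha]].

Definition CnHoelder_norm (n : nat) (alpha : R) gamma : R :=
  \sum_(k < n.+1) sup [set enorm (cderive01n k gamma t) | t in `[0, 1]]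
  + hoelder_seminorm alpha (cderive01n n gamma).

(* The pair (a, b) encodes the monomial x^a y^b. *)
Definition monomial : Type := (nat * nat)%type.

Definition monomial_eval (m : monomial) (p : R * R) : R :=
  p.1 ^+ m.1 * p.2 ^+ m.2.

Definition mdegree (m : monomial) : nat := (m.1 + m.2)%N.

(* Row index i : 'I_n stands for the derivative of order i + 1. *)
Definition Wdet (n : nat) (M : n.-tuple monomial) gamma t : R :=
  \det (\matrix_(i < n, j < n)
          derive01n i.+1 (fun u => monomial_eval (tnth M j) (gamma u)) t).

Definition eexp (n : nat) (M : n.-tuple monomial) : R :=
  2 / (n%:R * n.+1%:R) * (\sum_(m <- M) mdegree m)%N%:R.

Definition curve gamma : set (R * R) := gamma @` `[0, 1].

Definition neighborhood (delta : R) (G : set (R * R)) : set (R * R) :=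
  [set p | exists2 q, G q & enorm (p - q) < delta].

Definition lattice (N : nat) : set (R * R) :=
  [set p | exists a b : int, p = (a%:~R / N%:R, b%:~R / N%:R)].

End Defs.

(* Main.v *)
Require Import Defs.
From HB Require Import structures.
From mathcomp Require Import all_boot all_order all_algebra.
From mathcomp Require Import finmap.
From mathcomp Require Import all_classical all_reals all_analysis.
From mathcomp Require Import perm ring lra zify.

Set Implicit Arguments.
Unset Strict Implicit.
Unset Printing Implicit Defensive.

Import Order.TTheory GRing.Theory Num.Theory.
Import numFieldNormedType.Exports.

Local Open Scope classical_set_scope.
Local Open Scope ring_scope.

(* The determinant method. Put e' = e(M) + eps; when e' >= 1, or when N is
   bounded, the bound O(N) coming from the length of the curve suffices.
   Otherwise cut [0, 1] into windows of length l = N^(- e'). For n + 1 lattice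
   points p_i close to the arc over a window, Taylor expansion shows that the
   determinant of (1, m_1(p_i), ..., m_n(p_i))_i is O(l^(n(n+1)/2)), the
   distance d/N^n to the curve being absorbed by the Taylor remainder O(l^n).
   Times N^(deg m_1 + ... + deg m_n) this determinant is an integer, and it is
   less than 1, hence 0. So the points of a window are zeros of one nontrivial
   combination P of 1, m_1, ..., m_n, and P(gamma) = O(N^-n) at the
   corresponding times. If there were too many points, 2^n of those times would
   be separated by a large multiple of 1/N, and the mean value theorem would
   make the first n derivatives of P(gamma) small on the window, against the
   lower bound on the Wronskian. Hence a window contains O(1) points.
   All constants are uniform in M because e(M) < 1 bounds the degrees. *)

(** * Determinants *)

Lemma norm_det_le (R : realDomainType) (n : nat) (M : 'M[R]_n) (B : R) :
  (forall i j, `|M i j| <= B) -> `|\det M| <= (n`!)%:R * B ^+ n.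
Proof.
move=> MB; rewrite /determinant.
apply: le_trans (ler_norm_sum _ _ _) _.
have -> : (n`!)%:R * B ^+ n = \sum_(s : 'S_n) B ^+ n.
  by rewrite sumr_const card_Sn mulr_natl.
apply: ler_sum => s _; rewrite normrM normr_sign mul1r normr_prod.
rewrite -[n in X in _ <= X]card_ord -prodr_const.
by apply: ler_prod => i _; rewrite normr_ge0 MB.
Qed.

(** Each [k] is the number of [m < n] below it, so the two sums can be compared layer by layer: [f]
    is injective on the indices with value at most [m], so there are at most [m + 1] of them. The
    value [n] may repeat, as it will be the index of the remainder terms. *)
Lemma leq_sum_injective_below (n : nat) (f : 'I_n.+1 -> 'I_n.+1) :
  (forall i j, f i = f j -> (f i < n)%N -> i = j) ->
  (\sum_(k < n.+1) k <= \sum_i f i)%N.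
Proof.
move=> finj.
have layers (k : 'I_n.+1) : k = (\sum_(m < n) (m < k))%N :> nat.
  rewrite -big_mkcond /= -(big_ord_widen n (fun=> 1%N)); last by rewrite -ltnS.
  by rewrite sum1_card card_ord.
rewrite (eq_bigr _ (fun k _ => layers k)).
rewrite [leqRHS](eq_bigr _ (fun i _ => layers (f i))).
rewrite exchange_big [leqRHS]exchange_big /=; apply: leq_sum => m _.
rewrite -!big_mkcond /= !sum1_card.
rewrite -(leq_add2r #|[pred i | ~~ (m < f i)%N]|).
have -> : (#|[pred i | m < f i]| + #|[pred i | ~~ (m < f i)]| = n.+1)%N.
  by rewrite -[RHS]card_ord -(cardC [pred i | (m < f i)%N]).
rewrite -[leqRHS]card_ord -(cardC [pred k : 'I_n.+1 | (m < k)%N]) leq_add2l.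
have inj : {in [pred i | ~~ (m < f i)%N] &, injective f}.
  move=> i j; rewrite !inE -leqNgt => fim _ /finj; apply.
  exact: leq_ltn_trans fim (ltn_ord m).
rewrite -(card_in_image inj); apply: subset_leq_card.
apply/fintype.subsetP => k /fintype.imageP[i].
by rewrite !inE => h ->.
Qed.

(* Expand the determinant over the choice [f i] of a term in each row: if a
   term of index less than n is chosen twice, then two rows are proportional;
   otherwise the exponents add up to at least 0 + 1 + ... + n. *)
Lemma norm_det_flag_le (R : realFieldType) (n : nat) (l B : R)
    (c : 'I_n.+1 -> 'I_n.+1 -> R) (b : 'I_n.+1 -> 'I_n.+1 -> 'I_n.+1 -> R) :
  0 <= l <= 1 ->
  (forall i k, `|c i k| <= l ^+ k) -> (forall i k j, `|b i k j| <= B) ->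
  (forall i i' (k : 'I_n.+1) j, (k < n)%N -> b i k j = b i' k j) ->
  `|\det (\matrix_(i, j) \sum_k c i k * b i k j)|
    <= (n.+1 ^ n.+1)%:R * (((n.+1)`!)%:R * B ^+ n.+1)
         * l ^+ (\sum_(k < n.+1) k).
Proof.
move=> /andP[l0 l1] cl bB bE.
have -> : \det (\matrix_(i, j) \sum_k c i k * b i k j) =
    \sum_(f : {ffun 'I_n.+1 -> 'I_n.+1})
      (\prod_i c i (f i)) * \det (\matrix_(i, j) b i (f i) j).
  rewrite /determinant.
  under eq_bigr => s _.
    under eq_bigr => i _ do rewrite mxE.
    rewrite bigA_distr_bigA big_distrr /=.
    over.
  rewrite exchange_big /=; apply: eq_bigr => f _.
  rewrite big_distrr; apply: eq_bigr => s _ /=.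
  rewrite big_split /= mulrCA; congr (_ * (_ * _)).
  by apply: eq_bigr => i _; rewrite mxE.
apply: le_trans (ler_norm_sum _ _ _) _.
have -> : (n.+1 ^ n.+1)%:R * (((n.+1)`!)%:R * B ^+ n.+1)
    * l ^+ (\sum_(k < n.+1) k)
  = \sum_(f : {ffun 'I_n.+1 -> 'I_n.+1})
     (l ^+ (\sum_(k < n.+1) k) * (((n.+1)`!)%:R * B ^+ n.+1)).
  rewrite sumr_const card_ffun card_ord -[RHS]mulr_natl -mulrA.
  by congr (_ * _); rewrite mulrC.
apply: ler_sum => f _; rewrite normrM.
have [finj|] := pselect (forall i j, f i = f j -> (f i < n)%N -> i = j).
  apply: ler_pM => //; last first.
    by apply: norm_det_le => i j; rewrite mxE.
  rewrite normr_prod.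
  apply: le_trans (_ : \prod_i l ^+ f i <= _).
    by apply: ler_prod => i _; rewrite normr_ge0 cl.
  rewrite -expr_sum; apply: ler_wiXn2l => //.
  exact: leq_sum_injective_below.
move=> /existsNP[i /existsNP[j /not_implyP[fij /not_implyP[fin /eqP nij]]]].
rewrite (determinant_alternate (i1 := i) (i2 := j)) //; last first.
  by move=> k; rewrite !mxE -fij; apply: bE.
rewrite normr0 mulr0 !mulr_ge0 ?exprn_ge0 //.
exact: le_trans (normr_ge0 _) (bB ord0 ord0 ord0).
Qed.

(** Full column rank would provide an invertible choice of [n] rows. Choices with repeated rows are
    harmless, their determinant being 0 anyway. *)
Lemma exists_kernel_of_minors (F : fieldType) (m n : nat) (X : 'M[F]_(m, n)) :
  (forall f : 'I_n -> 'I_m, \det (rowsub f X) = 0) ->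
  exists2 v : 'cV[F]_n, v != 0 & X *m v = 0.
Proof.
move=> minors.
have : ~~ row_full X.
  apply/negP => fX; have := minors (fullrankfun fX).
  have := fullrowsub_unit fX; rewrite unitmxE unitfE => /eqP dn d0.
  exact: dn d0.
move=> nfX; have /rowV0Pn : kermx X^T != 0.
  by rewrite kermx_eq0 /row_free mxrank_tr.
case=> v /sub_kermxP vX v0; exists v^T.
  by rewrite -trmx0 (inj_eq trmx_inj).
by rewrite -[X]trmxK -trmx_mul vX trmx0.
Qed.

(** Cramer's rule: multiply [W *m v] by the adjugate, whose entries are minors of size [n - 1]. *)
Lemma norm_coef_le_of_det_ge (R : realFieldType) (n : nat) (W : 'M[R]_n)
    (v : 'cV[R]_n) (K c0 e : R) :
  0 < c0 -> c0 <= \det W -> (forall i j, `|W i j| <= K) ->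
  (forall i, `|(W *m v) i 0| <= e) ->
  forall j, `|v j 0| <= n%:R * (((n.-1)`!)%:R * K ^+ n.-1) * e / c0.
Proof.
move=> c00 cW WK We j.
rewrite ler_pdivlMr //.
apply: le_trans (_ : `|v j 0| * \det W <= _); first by rewrite ler_wpM2l.
have := congr1 (mulmx^~ v) (mul_adj_mx W).
rewrite -mulmxA mul_scalar_mx => /matrixP/(_ j 0); rewrite mxE [RHS]mxE => E.
have -> : `|v j 0| * \det W = `|\det W * v j 0|.
  by rewrite normrM mulrC (ger0_norm (le_trans (ltW c00) cW)).
rewrite -E; apply: le_trans (ler_norm_sum _ _ _) _.
rewrite -mulrA mulr_natl -[n in X in _ <= X]card_ord -sumr_const.
apply: ler_sum => i _; rewrite normrM ler_pM //.
rewrite mxE /cofactor normrM normr_sign mul1r.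
by rewrite card_ord; apply: norm_det_le => a b; rewrite !mxE.
Qed.

(** * Derivatives within the unit interval *)

Section OneSidedDerivatives.
Variable R : realType.
Implicit Types (f g : R -> R) (t : R).

Definition at01 (t : R) : set_system R := within `[0, 1]%classic t^'.

(** A relational form of [derive01], for which the rules of calculus can be stated without [lim]. *)
Definition has_deriv01 (f g : R -> R) : Prop :=
  forall t, t \in `[0, 1] -> diffquot f t y @[y --> at01 t] --> g t.

Lemma near_at01 (t : R) (P : R -> Prop) :
  (at01 t P) <->
  exists2 e : R, 0 < e &
    forall y, y \in `[0, 1] -> y != t -> `|y - t| < e -> P y.
Proof.
split.
  move=> /nbhs_ballP[e /= e0 He]; exists e => // y y01 yt yte.
  apply: He => //; first by rewrite /ball /= distrC.
case=> e e0 He; apply/nbhs_ballP; exists e => //= y.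
rewrite /ball /= distrC => yte yt y01; apply: He => //.
Qed.

#[local] Instance at01_filter t : Filter (at01 t).
Proof. exact: within_filter. Qed.

(** Properness makes limits unique. There is room of length 1/2 to the right of [t] when
    [t < 1 / 2], and to its left otherwise. *)
Lemma at01_proper t : t \in `[0, 1] -> ProperFilter (at01 t).
Proof.
rewrite in_itv /= => /andP[t0 t1]; apply: Build_ProperFilter_ex => P.
move=> /near_at01[e e0 He].
pose s := Num.min (e / 2) (1 / 2).
have s0 : 0 < s by rewrite /s lt_min; apply/andP; split; lra.
have se : s < e by rewrite /s gt_min; apply/orP; left; lra.
have s2 : s <= 1 / 2 by rewrite /s ge_min lexx orbT.
have [th|th] := ltP t (1 / 2).
  exists (t + s); apply: He; first by rewrite in_itv /=; lra.
    by rewrite gt_eqF // ltrDl.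
  by rewrite addrC addKr gtr0_norm.
exists (t - s); apply: He; first by rewrite in_itv /=; lra.
  by rewrite lt_eqF // ltrBlDr ltrDl.
by rewrite addrC addKr normrN gtr0_norm.
Qed.

Lemma at01_le_nbhs (T : topologicalType) (f : R -> T) t (l : set_system T) :
  f y @[y --> t] --> l -> f y @[y --> at01 t] --> l.
Proof.
move=> h; apply: cvg_trans h; apply: cvg_app.
exact: cvg_trans (cvg_within _) (cvg_within _).
Qed.

Lemma near_at01_itv t (P : R -> Prop) :
  (forall y, y \in `[0, 1] -> y != t -> P y) -> at01 t P.
Proof. by move=> h; apply/near_at01; exists 1 => // y *; apply: h. Qed.

Lemma derivable01_has_deriv f :
  (forall t, t \in `[0, 1] -> derivable01 f t) -> has_deriv01 f (derive01 f).
Proof. by move=> df t /df. Qed.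

Lemma has_deriv_derive01 f g t :
  t \in `[0, 1] -> has_deriv01 f g -> derive01 f t = g t.
Proof.
move=> t01 fg; have F := at01_proper t01.
exact: (cvg_lim (@Rhausdorff R) (fg t t01)).
Qed.

Lemma has_deriv_derivable01 f g t :
  t \in `[0, 1] -> has_deriv01 f g -> derivable01 f t.
Proof. by move=> t01 /(_ t t01) fg; apply: cvgP fg. Qed.

Lemma eq_has_deriv01 f f' g g' :
  {in `[0, 1], f =1 f'} -> {in `[0, 1], g =1 g'} ->
  has_deriv01 f g -> has_deriv01 f' g'.
Proof.
move=> ff gg fg t t01; rewrite -gg //; apply: cvg_trans (fg t t01).
apply: near_eq_cvg; apply: near_at01_itv => y y01 _.
by rewrite /diffquot !ff.
Qed.

Lemma has_deriv01_cvg f g t :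
  t \in `[0, 1] -> has_deriv01 f g -> f y @[y --> at01 t] --> f t.
Proof.
move=> t01 /(_ t t01) fg.
have c : (f t + diffquot f t y * (y - t)) @[y --> at01 t]
    --> f t + g t * (t - t).
  apply: cvgD; first exact: cvg_cst.
  apply: cvgM => //; apply: at01_le_nbhs.
  by apply: cvgB; [exact: cvg_id|exact: cvg_cst].
rewrite subrr mulr0 addr0 in c; apply: cvg_trans c.
apply: near_eq_cvg; apply: near_at01_itv => y _ yt.
by rewrite /diffquot divfK ?subr_eq0 // addrC subrK.
Qed.

Lemma has_deriv01_cst (c : R) : has_deriv01 (fun=> c) (fun=> 0).
Proof.
move=> t t01; rewrite /diffquot.
under eq_fun do rewrite subrr mul0r.
exact: cvg_cst.
Qed.

Lemma has_deriv01D f f' g g' : has_deriv01 f f' -> has_deriv01 g g' ->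
  has_deriv01 (fun t => f t + g t) (fun t => f' t + g' t).
Proof.
move=> ff gg t t01; apply: cvg_trans (cvgD (ff t t01) (gg t t01)).
apply: near_eq_cvg; apply: near_at01_itv => y _ _ /=.
rewrite /diffquot -[LHS]/((_ - _) / _ + (_ - _) / _) -mulrDl.
by congr (_ / _); ring.
Qed.

Lemma has_deriv01M f f' g g' : has_deriv01 f f' -> has_deriv01 g g' ->
  has_deriv01 (fun t => f t * g t) (fun t => f' t * g t + f t * g' t).
Proof.
move=> ff gg t t01.
have c : (diffquot f t y * g y + f t * diffquot g t y) @[y --> at01 t] -->
    f' t * g t + f t * g' t.
  apply: cvgD; first by apply: cvgM (ff t t01) (has_deriv01_cvg t01 gg).
  by apply: cvgM (gg t t01); apply: cvg_cst.
apply: cvg_trans c.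
apply: near_eq_cvg; apply: near_at01_itv => y _ _ /=.
by rewrite /diffquot; ring.
Qed.

Lemma has_deriv01_sum (I : Type) (r : seq I) (F F' : I -> R -> R) :
  (forall i, has_deriv01 (F i) (F' i)) ->
  has_deriv01 (fun t => \sum_(i <- r) F i t) (fun t => \sum_(i <- r) F' i t).
Proof.
move=> FF; elim: r => [|i r IH].
  by apply: (eq_has_deriv01 _ _ (has_deriv01_cst 0)) => t _; rewrite big_nil.
apply: (eq_has_deriv01 _ _ (has_deriv01D (FF i) IH)) => t _;
  by rewrite big_cons.
Qed.

Lemma has_deriv01Z (c : R) f g : has_deriv01 f g ->
  has_deriv01 (fun t => c * f t) (fun t => c * g t).
Proof.
move=> fg; have := has_deriv01M (has_deriv01_cst c) fg.
by apply: eq_has_deriv01 => t _ //; rewrite mul0r add0r.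
Qed.

(** At interior points the derivative within [0, 1] is the ordinary two-sided one, and
    differentiability within [0, 1] gives continuity up to [a] and [b]; so the classical theorem
    applies. *)
Lemma has_deriv01_MVT f g (a b : R) :
  a \in `[0, 1] -> b \in `[0, 1] -> a < b -> has_deriv01 f g ->
  exists2 c : R, c \in `]a, b[ & f b - f a = g c * (b - a).
Proof.
move=> a01 b01 ab fg.
have itv01 x : x \in `[a, b] -> x \in `[0, 1].
  by move: a01 b01; rewrite !in_itv /=; lra.
apply: MVT => //.
  move=> x xab.
  have x01 : x \in `[0, 1] by apply: itv01; apply: subset_itv_oo_cc.
  have c : h^-1 *: (f (h *: 1 + x) - f x) @[h --> (0:R)^'] --> g x.
    apply/cvgrPdist_lt => e e0.
    have /cvgrPdist_lt/(_ e e0)/near_at01[r r0 Hr] := fg x x01.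
    (* This radius keeps [h + x] between [a] and [b], hence in [0, 1]. *)
    apply/nbhs_ballP; exists (Num.min r (Num.min (x - a) (b - x))).
      move: xab; rewrite in_itv /= => /andP[ax xb].
      by rewrite /= !lt_min r0 !subr_gt0 ax xb.
    move=> h /=; rewrite /ball /= sub0r normrN !lt_min => /and3P[hr ha hb] h0.
    have := Hr (h + x); rewrite /diffquot addrK [_ / _]mulrC.
    rewrite /GRing.scale /= mulr1; apply => //.
      apply: itv01; rewrite in_itv /=.
      by move: ha hb; rewrite !ltr_norml; lra.
    by rewrite -subr_eq0 addrK.
  split; first by apply: cvgP c.
  exact: cvg_lim c.
apply/subspace_continuousP => x /= xab.
have x01 := itv01 _ xab.
have cx := has_deriv01_cvg x01 fg.
apply/cvgrPdist_lt => e e0.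
have /cvgrPdist_lt/(_ e e0)/near_at01[r r0 Hr] := cx.
apply/nbhs_ballP; exists r => //= y.
rewrite /ball /= distrC => yr yab.
have [->|yx] := eqVneq y x; first by rewrite subrr normr0.
by apply: Hr => //; apply: itv01.
Qed.

Lemma has_deriv01_lipschitz f g (K : R) :
  has_deriv01 f g -> (forall t, t \in `[0, 1] -> `|g t| <= K) ->
  forall s t, s \in `[0, 1] -> t \in `[0, 1] -> `|f s - f t| <= K * `|s - t|.
Proof.
move=> fg gK.
have lt_case s t : s \in `[0, 1] -> t \in `[0, 1] -> s < t ->
    `|f t - f s| <= K * `|t - s|.
  move=> s01 t01 st; have [c cst ->] := has_deriv01_MVT s01 t01 st fg.
  rewrite normrM ler_wpM2r // gK //.
  by move: s01 t01 cst; rewrite !in_itv /=; lra.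
move=> s t s01 t01; have [st|ts|->] := ltgtP s t.
- by rewrite distrC [X in _ <= _ * X]distrC; apply: lt_case.
- exact: lt_case.
- by rewrite !subrr normr0 mulr0.
Qed.

Lemma has_deriv01_subXn (a : R) (k : nat) :
  has_deriv01 (fun s => (s - a) ^+ k) (fun s => k%:R * (s - a) ^+ k.-1).
Proof.
elim: k => [|k IH].
  by apply: (eq_has_deriv01 _ _ (has_deriv01_cst 1)) => s _;
    rewrite ?expr0 ?mul0r.
have d1 : has_deriv01 (fun s => s - a) (fun=> 1).
  move=> t t01.
  apply: cvg_trans (cvg_cst _ : (fun=> 1 : R) @ at01 t --> (1 : R)).
  apply: near_eq_cvg; apply: near_at01_itv => y _ yt.
  by rewrite /diffquot opprB addrA subrK divff // subr_eq0.
apply: (eq_has_deriv01 _ _ (has_deriv01M d1 IH)) => s _; first by rewrite exprS.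
rewrite mul1r /= mulrCA; case: k {IH} => [|k].
  by rewrite mul0r !mul1r addr0.
by rewrite /= -exprS -(natr1 k.+1) mulrDl mul1r addrC.
Qed.

(** Induction on [n]: the remainder vanishes at [t0], and its derivative is the remainder of the
    previous order for the shifted family [F k.+1]; the mean value theorem gains one factor
    [t - t0]. The usual factorial in the denominator is given up. *)
Lemma taylor01_bound (n : nat) (F : nat -> R -> R) (K t0 t : R) :
  (forall k, (k < n)%N -> has_deriv01 (F k) (F k.+1)) ->
  (forall s : R, s \in `[0, 1] -> `|F n s| <= K) ->
  t0 \in `[0, 1] -> t \in `[0, 1] ->
  `|F 0%N t - \sum_(k < n) (t - t0) ^+ k * (F k t0 / k`!%:R)|
    <= K * `|t - t0| ^+ n.
Proof.
elim: n F t => [|n IH] F t FF FK t001 t01.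
  by rewrite big_ord0 subr0 expr0 mulr1 FK.
pose T s := \sum_(k < n.+1) (s - t0) ^+ k * (F k t0 / k`!%:R).
pose T' s := \sum_(k < n) (s - t0) ^+ k * (F k.+1 t0 / k`!%:R).
have TT : has_deriv01 T T'.
  have D := has_deriv01D (has_deriv01_cst (F 0%N t0)) (has_deriv01_sum
    (r := index_enum 'I_n) (fun k : 'I_n =>
       has_deriv01Z (c := F k.+1 t0 / (k.+1)`!%:R)
         (@has_deriv01_subXn t0 k.+1))).
  apply: (eq_has_deriv01 _ _ D) => s _ /=.
    rewrite /T big_ord_recl /= expr0 mul1r fact0 divr1; congr (_ + _).
    by apply: eq_bigr => i _; rewrite mulrC.
  rewrite add0r; apply: eq_bigr => i _.
  have : i.+1%:R != 0 :> R by rewrite pnatr_eq0.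
  have : i`!%:R != 0 :> R by rewrite pnatr_eq0 -lt0n fact_gt0.
  rewrite factS natrM /=; move: (i.+1%:R : R) (i`!%:R : R) => p q q0 p0.
  by field; rewrite q0 p0.
have g0 : F 0%N t0 - T t0 = 0.
  rewrite /T big_ord_recl /= expr0 mul1r fact0 divr1 big1 ?addr0 ?subrr //.
  by move=> i _; rewrite expr0n mul0r.
have gg : has_deriv01 (fun s => F 0%N s - T s) (fun s => F 1%N s - T' s).
  have D := has_deriv01D (FF 0%N (ltn0Sn _)) (has_deriv01Z (c := -1) TT).
  by apply: (eq_has_deriv01 _ _ D) => s _; rewrite mulN1r.
have bnd s : s \in `[0, 1] -> `|F 1%N s - T' s| <= K * `|s - t0| ^+ n.
  by move=> s01; apply: (IH (fun k => F k.+1)) => // k kn; apply: FF.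
have [tt|tt|->] := ltgtP t t0.
- have [c ctt E] := has_deriv01_MVT t01 t001 tt gg.
  rewrite g0 sub0r in E; rewrite -normrN E normrM exprSr mulrA -(distrC t t0).
  have c01 : c \in `[0, 1].
    by move: t01 t001 ctt; rewrite !in_itv /=; lra.
  apply: ler_wpM2r => //; apply: le_trans (bnd c c01) _.
  apply: ler_wpM2l; first exact: le_trans (normr_ge0 _) (FK _ t01).
  apply: lerXn2r; rewrite ?nnegrE //.
  move: ctt; rewrite in_itv /= => ctt.
  by rewrite !ltr0_norm; lra.
- have [c ctt E] := has_deriv01_MVT t001 t01 tt gg.
  rewrite g0 subr0 in E; rewrite E normrM exprSr mulrA.
  have c01 : c \in `[0, 1].
    by move: t01 t001 ctt; rewrite !in_itv /=; lra.
  apply: ler_wpM2r => //; apply: le_trans (bnd c c01) _.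
  apply: ler_wpM2l; first exact: le_trans (normr_ge0 _) (FK _ t01).
  apply: lerXn2r; rewrite ?nnegrE //.
  move: ctt; rewrite in_itv /= => ctt.
  by rewrite !gtr0_norm; lra.
- by rewrite /T in g0; rewrite g0 normr0 mulr_ge0 ?exprn_ge0 //;
    apply: le_trans (normr_ge0 _) (FK _ t01).
Qed.

(* Each application of the mean value theorem to consecutive pairs of points
   halves their number and keeps them separated. *)
Lemma small_derivative_of_separated (n : nat) (F : nat -> R -> R)
    (h e a b : R) (x : nat -> R) :
  0 < h -> a \in `[0, 1] -> b \in `[0, 1] ->
  (forall k, (k < n)%N -> has_deriv01 (F k) (F k.+1)) ->
  (forall i, (i < 2 ^ n)%N -> a <= x i <= b /\ `|F 0%N (x i)| <= e) ->
  (forall i, (i.+1 < 2 ^ n)%N -> x i + h <= x i.+1) ->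
  forall k, (k <= n)%N ->
    exists2 y : R, a <= y <= b & `|F k y| <= e * (2 / h) ^+ k.
Proof.
move=> h0 a01 b01.
elim: n F e x => [|n IH] F e x FF Fx xh [|k] kn.
- by have [? ?] := Fx 0%N isT; exists (x 0%N); rewrite ?expr0 ?mulr1.
- by [].
- have [? ?] : a <= x 0%N <= b /\ `|F 0%N (x 0%N)| <= e.
    by apply: Fx; rewrite expn_gt0.
  by exists (x 0%N); rewrite ?expr0 ?mulr1.
(* The bound on [i] sits under the existential so that [choice] yields a total function; 0 is its
   value out of range. *)
have pairs i : exists y, (i < 2 ^ n)%N ->
    [/\ x i.*2 < y, y < x i.*2.+1 & `|F 1%N y| <= e * (2 / h)].
  have [ilt|] := ltnP i (2 ^ n); last by exists 0.
  have i1 : (i.*2.+1 < 2 ^ n.+1)%N by rewrite expnS; lia.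
  have i0 : (i.*2 < 2 ^ n.+1)%N by rewrite expnS; lia.
  have [/andP[xa xb] Fe] := Fx _ i0.
  have [/andP[xa' xb'] Fe'] := Fx _ i1.
  have sep := xh _ i1.
  have in01 t : a <= t <= b -> t \in `[0, 1].
    by move: a01 b01; rewrite !in_itv /=; lra.
  have lt : x i.*2 < x i.*2.+1 by lra.
  have [y] := has_deriv01_MVT (in01 _ (introT andP (conj xa xb)))
    (in01 _ (introT andP (conj xa' xb'))) lt (FF 0%N (ltn0Sn _)).
  rewrite in_itv /= => /andP[y0 y1] E; exists y => _; split => //.
  (* Two values of size at most [e] differ by at most [2 * e], over a gap of at least [h]: hence the
     factor [2 / h]. *)
  have le2e : `|F 1%N y| * (x i.*2.+1 - x i.*2) <= 2 * e.
    rewrite -[x i.*2.+1 - _]gtr0_norm ?subr_gt0 // -normrM -E.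
    by apply: le_trans (ler_normB _ _) _; lra.
  rewrite mulrA ler_pdivlMr // mulrC [e * 2]mulrC; apply: le_trans le2e.
  by rewrite mulrC ler_wpM2l //; lra.
have {pairs} [y Hy] := choice pairs.
have Fy i : (i < 2 ^ n)%N -> a <= y i <= b /\ `|F 1%N (y i)| <= e * (2 / h).
  move=> ilt; have [y0 y1 Fy] := Hy i ilt; split => //.
  have i1 : (i.*2.+1 < 2 ^ n.+1)%N by rewrite expnS; lia.
  have [/andP[xa xb] _] := Fx _ (ltnW i1).
  by have [/andP[xa' xb'] _] := Fx _ i1; lra.
(* Between [y i] and [y i.+1] lies the whole gap from [x i.*2.+1] to [x i.*2.+2]. *)
have yh i : (i.+1 < 2 ^ n)%N -> y i + h <= y i.+1.
  move=> ilt; have [y0 y1 _] := Hy i (ltnW ilt).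
  have [y0' _ _] := Hy _ ilt.
  have i2 : (i.*2.+2 < 2 ^ n.+1)%N by rewrite expnS; lia.
  by have := xh _ i2; rewrite doubleS in y0'; lra.
have [z zab Fz] := IH (fun k => F k.+1) (e * (2 / h)) y
  (fun j jn => FF j.+1 jn) Fy yh k kn.
by exists z => //; rewrite exprS mulrA.
Qed.

End OneSidedDerivatives.

(** * Functions with bounded Hoelder derivatives *)

Section SmoothFunctions.
Variables (R : realType) (b : R).
Implicit Types (f g : R -> R) (K L : R).

(** A single constant for both the size and the Hoelder seminorm of exponent [b]: the estimates for
    sums and products then track one number. *)
Definition hoelder_bounded K f : Prop := forall s t : R,
  s \in `[0, 1] -> t \in `[0, 1] ->
  `|f s| <= K /\ `|f s - f t| <= K * `|s - t| `^ b.

(** The Hoelder condition is imposed at all orders up to [k], so that products can be treated by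
    induction on [k]. *)
Definition smooth01 (k : nat) K f : Prop :=
  (forall (i : nat) (t : R), (i < k)%N -> t \in `[0, 1] ->
     derivable01 (derive01n i f) t) /\
  (forall i : nat, (i <= k)%N -> hoelder_bounded K (derive01n i f)).

Let mem0 : (0 : R) \in `[0, 1]. Proof. by rewrite in_itv /= lexx ler01. Qed.

Lemma derive01nSr i f : derive01n i.+1 f = derive01n i (derive01 f).
Proof. exact: iterSr. Qed.

(** Peels off the innermost derivative, whereas [derive01n] unfolds from the outside; in this form
    the rules for first derivatives feed an induction on [k]. *)
Lemma smooth01S k K f : smooth01 k.+1 K f <->
  [/\ forall t, t \in `[0, 1] -> derivable01 f t, hoelder_bounded K f
    & smooth01 k K (derive01 f)].
Proof.
split.
  case=> df bf; split => [t t01||]; [exact: (df 0%N)|exact: (bf 0%N)|split].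
    by move=> i t ik t01; rewrite -derive01nSr; apply: df.
  by move=> i ik; rewrite -derive01nSr; apply: bf.
case=> df bf [ddf bdf]; split.
  case=> [|i] t ik t01; first exact: df.
  by rewrite derive01nSr; apply: ddf.
by case=> [|i] ik //; rewrite derive01nSr; apply: bdf.
Qed.

Lemma smooth01_has_deriv k K f i : smooth01 k K f -> (i < k)%N ->
  has_deriv01 (derive01n i f) (derive01n i.+1 f).
Proof. by case=> df _ ik; apply: derivable01_has_deriv => t; apply: df. Qed.

Lemma hoelder_bounded_ge0 K f : hoelder_bounded K f -> 0 <= K.
Proof. by move=> /(_ 0 0 mem0 mem0)[/(le_trans (normr_ge0 _))]. Qed.

Lemma hoelder_bounded_le K L f :
  K <= L -> hoelder_bounded K f -> hoelder_bounded L f.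
Proof.
move=> KL bf s t s01 t01; have [h1 h2] := bf s t s01 t01; split.
  exact: le_trans KL.
by apply: le_trans h2 _; rewrite ler_wpM2r // powR_ge0.
Qed.

Lemma eq_hoelder_bounded K f g :
  {in `[0, 1], f =1 g} -> hoelder_bounded K f -> hoelder_bounded K g.
Proof. by move=> fg bf s t s01 t01; rewrite -!fg //; apply: bf. Qed.

Lemma hoelder_boundedD K L f g : hoelder_bounded K f -> hoelder_bounded L g ->
  hoelder_bounded (K + L) (fun t => f t + g t).
Proof.
move=> bf bg s t s01 t01.
have [f1 f2] := bf s t s01 t01; have [g1 g2] := bg s t s01 t01; split.
  by apply: le_trans (ler_normD _ _) _; apply: lerD.
rewrite mulrDl opprD addrACA.
by apply: le_trans (ler_normD _ _) _; apply: lerD.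
Qed.

Lemma hoelder_boundedM K L f g : hoelder_bounded K f -> hoelder_bounded L g ->
  hoelder_bounded (2 * (K * L)) (fun t => f t * g t).
Proof.
move=> bf bg s t s01 t01.
have K0 := hoelder_bounded_ge0 bf; have L0 := hoelder_bounded_ge0 bg.
have [f1 f2] := bf s t s01 t01; have [g1 g2] := bg s t s01 t01.
have [g3 _] := bg t t t01 t01.
split.
  rewrite normrM; apply: le_trans (ler_pM _ _ f1 g1) _ => //.
  by rewrite ler_peMl ?mulr_ge0 // ler1n.
have -> : f s * g s - f t * g t = f s * (g s - g t) + g t * (f s - f t) by ring.
apply: le_trans (ler_normD _ _) _; rewrite !normrM.
have := ler_pM (normr_ge0 _) (normr_ge0 _) f1 g2.
have := ler_pM (normr_ge0 _) (normr_ge0 _) g3 f2.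
by lra.
Qed.

Lemma smooth01_le j k K L f :
  (j <= k)%N -> K <= L -> smooth01 k K f -> smooth01 j L f.
Proof.
move=> jk KL [df bf]; split.
  by move=> i t ij; apply: df; apply: leq_trans jk.
by move=> i ij; apply: hoelder_bounded_le KL _; apply: bf; apply: leq_trans jk.
Qed.

(** Derivatives within [0, 1] see only the values on [0, 1], so agreement there passes to the
    derivatives of every order. *)
Lemma eq_smooth01 k K f g :
  {in `[0, 1], f =1 g} -> smooth01 k K f -> smooth01 k K g.
Proof.
elim: k f g => [|k IH] f g fg.
  case=> _ bf; split => // -[|//] _; apply: eq_hoelder_bounded fg _.
  exact: (bf 0%N).
case/smooth01S => df bf sf; apply/smooth01S.
have D : has_deriv01 g (derive01 f).
  by apply: eq_has_deriv01 (derivable01_has_deriv df).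
split=> [t t01||]; first exact: has_deriv_derivable01 D.
  exact: eq_hoelder_bounded bf.
by apply: IH sf => t t01; rewrite (has_deriv_derive01 t01 D).
Qed.

Lemma smooth01_deriv k K f g : has_deriv01 f g -> hoelder_bounded K f ->
  smooth01 k K g -> smooth01 k.+1 K f.
Proof.
move=> fg bf sg; apply/smooth01S; split => // [t t01|].
  exact: has_deriv_derivable01 fg.
by apply: eq_smooth01 sg => t t01; rewrite (has_deriv_derive01 t01 fg).
Qed.

Lemma smooth01D k K L f g : smooth01 k K f -> smooth01 k L g ->
  smooth01 k (K + L) (fun t => f t + g t).
Proof.
elim: k f g => [|k IH] f g.
  case=> _ bf [_ bg]; split => // -[|//] _.
  by apply: hoelder_boundedD; [apply: (bf 0%N)|apply: (bg 0%N)].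
case/smooth01S => df bf sf; case/smooth01S => dg bg sg.
apply: (smooth01_deriv (has_deriv01D (derivable01_has_deriv df)
  (derivable01_has_deriv dg))); last exact: IH.
exact: hoelder_boundedD.
Qed.

(** The derivative of a product is a sum of two products, so the constant doubles at each order. *)
Lemma smooth01M k K L f g : smooth01 k K f -> smooth01 k L g ->
  smooth01 k (2 ^+ k.+1 * (K * L)) (fun t => f t * g t).
Proof.
elim: k f g => [|k IH] f g.
  case=> _ bf [_ bg]; split => // -[|//] _; rewrite expr1.
  by apply: hoelder_boundedM; [apply: (bf 0%N)|apply: (bg 0%N)].
move=> sf sg.
have /smooth01S[df bf sdf] := sf; have /smooth01S[dg bg sdg] := sg.
have K0 := hoelder_bounded_ge0 bf; have L0 := hoelder_bounded_ge0 bg.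
apply: (smooth01_deriv (has_deriv01M (derivable01_has_deriv df)
  (derivable01_has_deriv dg))).
  apply: hoelder_bounded_le (hoelder_boundedM bf bg).
  rewrite [2 ^+ k.+2]exprS -mulrA ler_wpM2l // ler_peMl ?mulr_ge0 //.
  by rewrite exprn_ege1 // ler1n.
have -> : 2 ^+ k.+2 * (K * L) = 2 ^+ k.+1 * (K * L) + 2 ^+ k.+1 * (K * L).
  by rewrite exprS; ring.
have sf' := smooth01_le (leqnSn k) (lexx K) sf.
have sg' := smooth01_le (leqnSn k) (lexx L) sg.
by apply: smooth01D; apply: IH.
Qed.

Lemma smooth01_cst k (c : R) : smooth01 k `|c| (fun=> c).
Proof.
elim: k c => [|k IH] c.
  split=> // -[|//] _ s t s01 t01; split => //=.
  by rewrite subrr normr0 mulr_ge0 ?powR_ge0.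
apply: (smooth01_deriv (has_deriv01_cst c)).
  by move=> s t s01 t01; split => //=; rewrite subrr normr0 mulr_ge0 ?powR_ge0.
by apply: smooth01_le (IH 0); rewrite ?normr0.
Qed.

Lemma smooth01X k K f (a : nat) : smooth01 k K f ->
  smooth01 k ((2 ^+ k.+1 * K) ^+ a) (fun t => f t ^+ a).
Proof.
move=> sf; elim: a => [|a IH].
  by rewrite expr0 -normr1; apply: smooth01_cst.
rewrite [X in smooth01 _ X]exprS -mulrA.
by apply: eq_smooth01 (smooth01M sf IH) => t _; rewrite exprS.
Qed.

End SmoothFunctions.

(** * Norm bounds along the curve and for monomials *)

Section Curve.
Variable R : realType.
Implicit Types (f : R -> R) (gamma : R -> R * R) (t : R).

Let mem0 : (0 : R) \in `[0, 1]. Proof. by rewrite in_itv /= lexx ler01. Qed.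

Lemma norm_fst_le_enorm (p : R * R) : `|p.1| <= enorm p.
Proof.
rewrite /enorm -sqrtr_sqr ler_sqrt ?lerDl ?addr_ge0 ?sqr_ge0 //.
Qed.

Lemma norm_snd_le_enorm (p : R * R) : `|p.2| <= enorm p.
Proof.
rewrite /enorm -sqrtr_sqr ler_sqrt ?lerDr ?addr_ge0 ?sqr_ge0 //.
Qed.

Lemma enorm_le_normD (p : R * R) : enorm p <= `|p.1| + `|p.2|.
Proof.
rewrite /enorm -[leRHS]ger0_norm ?addr_ge0 // -sqrtr_sqr ler_sqrt ?sqr_ge0 //.
by rewrite sqrrD !real_normK ?num_real // lerD2r lerDl mulrn_wge0 ?mulr_ge0.
Qed.

(** Distances in [0, 1] are at most 1, so a smaller exponent gives a weaker bound. This allows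
    [alpha] to be replaced by [Num.min alpha 1]. *)
Lemma powR_dist01_le (a b s t : R) :
  0 < b -> b <= a -> s \in `[0, 1] -> t \in `[0, 1] ->
  `|s - t| `^ a <= `|s - t| `^ b.
Proof.
move=> b0 ba s01 t01; have [->|st] := eqVneq s t.
  by rewrite subrr normr0 !powR0 // gt_eqF //; apply: lt_le_trans ba.
apply: ger_powR => //; rewrite normr_gt0 subr_eq0 st /=.
by move: s01 t01; rewrite !in_itv /= ler_norml; lra.
Qed.

(** Needed because a supremum dominates the values only on a bounded set. Descending induction on
    the order: the top derivative is Hoelder on an interval of length 1, and each lower one is
    Lipschitz by the bound on the next. *)
Lemma bounded_derive01n (n : nat) (a K : R) f : 0 < a ->
  (forall (k : nat) t, (k < n)%N -> t \in `[0, 1] ->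
     derivable01 (derive01n k f) t) ->
  (forall s t, s \in `[0, 1] -> t \in `[0, 1] ->
     `|derive01n n f s - derive01n n f t| <= K * `|s - t| `^ a) ->
  forall k, (k <= n)%N ->
    exists B : R, forall t, t \in `[0, 1] -> `|derive01n k f t| <= B.
Proof.
move=> a0 df hf.
have ptle t : t \in `[0, 1] -> `|t| <= 1.
  by rewrite in_itv /= ler_norml; lra.
suff H j : (j <= n)%N -> exists B : R, forall t, t \in `[0, 1] ->
    `|derive01n (n - j) f t| <= B.
  by move=> k kn; have := H (n - k)%N (leq_subr _ _); rewrite subKn.
elim: j => [|j IH] jn.
  rewrite subn0; exists (`|K| + `|derive01n n f 0|) => t t01.
  rewrite -lerBlDr; apply: le_trans (lerB_dist _ _) _.
  apply: le_trans (hf t 0 t01 mem0) _; rewrite subr0.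
  apply: le_trans (_ : `|K| * `|t| `^ a <= _).
    by rewrite ler_wpM2r ?powR_ge0 ?ler_norm.
  rewrite ler_piMr // -[leRHS](_ : 1 `^ a = 1); last by rewrite powR1.
  by rewrite ge0_ler_powR ?nnegrE ?ptle // ltW.
have [B HB] := IH (ltnW jn).
have jn' : (n - j.+1 < n)%N by lia.
have E : ((n - j.+1).+1 = n - j)%N by lia.
have D := derivable01_has_deriv (fun t => df (n - j.+1)%N t jn').
rewrite -[derive01 _]/(derive01n (n - j.+1).+1 f) E in D.
exists (B + `|derive01n (n - j.+1) f 0|) => t t01.
rewrite -lerBlDr; apply: le_trans (lerB_dist _ _) _.
apply: le_trans (has_deriv01_lipschitz D HB t01 mem0) _.
rewrite subr0 ler_piMr ?ptle //; exact: le_trans (normr_ge0 _) (HB 0 mem0).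
Qed.

(** The suprema in the norm are over bounded sets, so each dominates its values; all being
    nonnegative, each is at most the norm. *)
Lemma sup_norms_le (n : nat) (alpha A : R) gamma : 0 < alpha ->
  CnHoelder n alpha gamma -> CnHoelder_norm n alpha gamma <= A ->
  (forall (k : nat) t, (k <= n)%N -> t \in `[0, 1] ->
     enorm (cderive01n k gamma t) <= A) /\
  (forall s t, s \in `[0, 1] -> t \in `[0, 1] ->
     enorm (cderive01n n gamma s - cderive01n n gamma t)
       <= A * `|s - t| `^ alpha).
Proof.
move=> alpha0 [dg [K HK]]; rewrite /CnHoelder_norm => normA.
have bnd1 := bounded_derive01n alpha0 (fun k t kn t01 => (dg k t kn t01).1)
  (fun s t s01 t01 => le_trans (norm_fst_le_enorm _) (HK s t s01 t01)).
have bnd2 := bounded_derive01n alpha0 (fun k t kn t01 => (dg k t kn t01).2)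
  (fun s t s01 t01 => le_trans (norm_snd_le_enorm _) (HK s t s01 t01)).
pose S k := [set enorm (cderive01n k gamma t) | t in `[0, 1]].
have S_le k t : (k <= n)%N -> t \in `[0, 1] ->
    enorm (cderive01n k gamma t) <= sup (S k).
  move=> kn t01; apply: ub_le_sup; last by exists t.
  have [B1 H1] := bnd1 k kn; have [B2 H2] := bnd2 k kn.
  exists (B1 + B2) => _ [s /= s01 <-]; apply: le_trans (enorm_le_normD _) _.
  by apply: lerD; [apply: H1|apply: H2].
have S0 k : (k <= n)%N -> 0 <= sup (S k).
  by move=> kn; apply: le_trans (S_le k 0 kn mem0); rewrite sqrtr_ge0.
pose H := [set r | exists s t : R, [/\ s \in `[0, 1], t \in `[0, 1], s != t &
  r = enorm (cderive01n n gamma s - cderive01n n gamma t) / `|s - t| `^ alpha]].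
have H_le s t : s \in `[0, 1] -> t \in `[0, 1] -> s != t ->
    enorm (cderive01n n gamma s - cderive01n n gamma t) / `|s - t| `^ alpha
      <= sup H.
  move=> s01 t01 st; apply: ub_le_sup; last by exists s, t.
  exists K => _ [u [v [u01 v01 uv ->]]]; rewrite ler_pdivrMr ?HK //.
  by rewrite powR_gt0 // normr_gt0 subr_eq0.
have mem1 : (1 : R) \in `[0, 1] by rewrite in_itv /= lexx ler01.
have H0 : 0 <= sup H.
  apply: le_trans (H_le 0 1 mem0 mem1 _); last by rewrite eq_sym oner_eq0.
  by rewrite divr_ge0 ?sqrtr_ge0 ?powR_ge0.
split=> [k t kn t01|s t s01 t01].
  apply: le_trans (S_le k t kn t01) _; apply: le_trans normA.
  rewrite (bigD1 (Ordinal (kn : (k < n.+1)%N))) //= -addrA lerDl addr_ge0 //.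
  by apply: sumr_ge0 => i _; apply: S0; rewrite -ltnS.
have [->|st] := eqVneq s t.
  by rewrite !subrr normr0 powR0 ?gt_eqF // mulr0 /enorm /= expr0n addr0 sqrtr0.
rewrite -ler_pdivrMr; last by rewrite powR_gt0 // normr_gt0 subr_eq0.
apply: le_trans (H_le s t s01 t01 st) _; apply: le_trans normA.
by rewrite lerDr; apply: sumr_ge0 => i _; apply: S0; rewrite -ltnS.
Qed.

(** Below order [n], the bound on the next derivative gives a Lipschitz condition, which implies the
    Hoelder condition since [beta <= 1]. *)
Lemma smooth01_of_bounds (n : nat) (alpha beta A : R) f :
  0 < beta -> beta <= alpha -> beta <= 1 ->
  (forall (k : nat) t, (k < n)%N -> t \in `[0, 1] ->
     derivable01 (derive01n k f) t) ->
  (forall (k : nat) t, (k <= n)%N -> t \in `[0, 1] ->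
     `|derive01n k f t| <= A) ->
  (forall s t, s \in `[0, 1] -> t \in `[0, 1] ->
     `|derive01n n f s - derive01n n f t| <= A * `|s - t| `^ alpha) ->
  smooth01 beta n A f.
Proof.
move=> b0 ba b1 df bf hf.
have A0 : 0 <= A by apply: le_trans (bf 0%N 0 _ mem0).
split=> // i; rewrite leq_eqVlt => /orP[/eqP->|ilt] s t s01 t01; split.
- exact: bf.
- by apply: le_trans (hf s t s01 t01) _; rewrite ler_wpM2l ?powR_dist01_le.
- exact: bf (ltnW ilt) s01.
have D := derivable01_has_deriv (fun t => df i t ilt).
apply: le_trans (has_deriv01_lipschitz D (fun t => bf i.+1 t ilt) s01 t01) _.
by rewrite ler_wpM2l // -[leLHS]powRr1 ?powR_dist01_le.
Qed.

Lemma smooth01_curve (n : nat) (alpha A : R) gamma : 0 < alpha ->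
  CnHoelder n alpha gamma -> CnHoelder_norm n alpha gamma <= A ->
  smooth01 (Num.min alpha 1) n A (fst \o gamma) /\
  smooth01 (Num.min alpha 1) n A (snd \o gamma).
Proof.
move=> alpha0 Cg Ag; have [bA hA] := sup_norms_le alpha0 Cg Ag.
have [dg _] := Cg.
have m0 : 0 < Num.min alpha 1 by rewrite lt_min alpha0 ltr01.
split; apply: (@smooth01_of_bounds n alpha); rewrite ?ge_min ?lexx ?orbT //.
- by move=> k t kn t01; have [] := dg k t kn t01.
- by move=> k t kn t01; apply: le_trans (bA k t kn t01);
  exact: (norm_fst_le_enorm (cderive01n k gamma t)).
- move=> s t s01 t01; apply: le_trans (hA s t s01 t01).
  exact: (norm_fst_le_enorm (cderive01n n gamma s - cderive01n n gamma t)).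
- by move=> k t kn t01; have [] := dg k t kn t01.
- by move=> k t kn t01; apply: le_trans (bA k t kn t01);
  exact: (norm_snd_le_enorm (cderive01n k gamma t)).
- move=> s t s01 t01; apply: le_trans (hA s t s01 t01).
  exact: (norm_snd_le_enorm (cderive01n n gamma s - cderive01n n gamma t)).
Qed.

(** The constant depends on [m] only through the degree bound [D], hence serves all monomials of [M]
    at once; [1 <= K] allows the exponent to be raised to [D]. *)
Lemma smooth01_monomial (b : R) (k D : nat) (K : R) (m : monomial) gamma :
  1 <= K -> (mdegree m <= D)%N ->
  smooth01 b k K (fst \o gamma) -> smooth01 b k K (snd \o gamma) ->
  smooth01 b k (2 ^+ k.+1 * (2 ^+ k.+1 * K) ^+ D)
    (fun t => monomial_eval m (gamma t)).
Proof.
move=> K1 mD s1 s2.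
have c1 : 1 <= 2 ^+ k.+1 * K.
  by rewrite mulr_ege1 // exprn_ege1 // ler1n.
apply: smooth01_le (leqnn k) _
  (smooth01M (smooth01X m.1 s1) (smooth01X m.2 s2)).
rewrite ler_wpM2l ?exprn_ge0 // -exprD; exact: ler_weXn2l.
Qed.

Lemma norm_exprB_le (B x y : R) (a : nat) : 1 <= B -> `|x| <= B -> `|y| <= B ->
  `|x ^+ a - y ^+ a| <= a%:R * B ^+ a * `|x - y|.
Proof.
move=> B1 xB yB; have B0 : 0 <= B by apply: le_trans B1.
elim: a => [|a IH]; first by rewrite subrr normr0 !mul0r.
have -> : x ^+ a.+1 - y ^+ a.+1 = x * (x ^+ a - y ^+ a) + y ^+ a * (x - y).
  by rewrite !exprS; ring.
apply: le_trans (ler_normD _ _) _; rewrite !normrM.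
have -> : a.+1%:R * B ^+ a.+1 * `|x - y| =
    B * (a%:R * B ^+ a * `|x - y|) + B * B ^+ a * `|x - y|.
  by rewrite -natr1 exprS; ring.
apply: lerD; first exact: ler_pM.
rewrite ler_wpM2r // normrX; apply: le_trans (_ : B ^+ a <= _).
  by rewrite lerXn2r ?nnegrE.
by rewrite ler_peMl ?exprn_ge0.
Qed.

(** Replace one coordinate at a time; each exchange costs at most [D * B ^ D * e]. *)
Lemma monomial_evalB_le (B e : R) (D : nat) (m : monomial) (p q : R * R) :
  1 <= B -> (mdegree m <= D)%N ->
  `|p.1| <= B -> `|p.2| <= B -> `|q.1| <= B -> `|q.2| <= B ->
  `|p.1 - q.1| <= e -> `|p.2 - q.2| <= e ->
  `|monomial_eval m p - monomial_eval m q| <= 2 * D%:R * B ^+ D * e.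
Proof.
move=> B1 mD p1 p2 q1 q2 e1 e2; have B0 : 0 <= B by apply: le_trans B1.
have e0 : 0 <= e by apply: le_trans e1.
rewrite /monomial_eval.
have -> : p.1 ^+ m.1 * p.2 ^+ m.2 - q.1 ^+ m.1 * q.2 ^+ m.2 =
  p.1 ^+ m.1 * (p.2 ^+ m.2 - q.2 ^+ m.2) +
  q.2 ^+ m.2 * (p.1 ^+ m.1 - q.1 ^+ m.1).
  by ring.
apply: le_trans (ler_normD _ _) _; rewrite !normrM !normrX.
have DB : B ^+ (m.1 + m.2) <= B ^+ D by apply: ler_weXn2l.
have half (a c : nat) (x y z : R) : (a + c = m.1 + m.2)%N ->
    `|x| <= B -> `|y| <= B -> `|z| <= B -> `|y - z| <= e ->
    `|x| ^+ a * `|y ^+ c - z ^+ c| <= D%:R * B ^+ D * e.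
  move=> ac xB yB zB yz.
  apply: le_trans (_ : B ^+ a * (c%:R * B ^+ c * e) <= _).
    apply: ler_pM; rewrite ?exprn_ge0 //; first by rewrite lerXn2r ?nnegrE.
    apply: le_trans (norm_exprB_le c B1 yB zB) _.
    by rewrite ler_wpM2l // mulr_ge0 ?exprn_ge0.
  rewrite mulrA ler_wpM2r // mulrCA -exprD ac.
  rewrite ler_pM ?exprn_ge0 // ler_nat.
  exact: leq_trans (leq_trans (leq_addl a c) (eq_leq ac)) mD.
have -> : 2 * D%:R * B ^+ D * e = D%:R * B ^+ D * e + D%:R * B ^+ D * e by ring.
by apply: lerD; apply: half => //; rewrite addnC.
Qed.

End Curve.

(** * Lattice points near the curve *)

(** Greedy choice: keep a point of least time, discard the points less than [h] after it, at most
    [D] of them, and repeat with the rest. *)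
Lemma exists_separated (R : realDomainType) (T : eqType) (tm : T -> R) (h : R)
    (D m : nat) (s : seq T) :
  (forall a, (count (fun p => (a <= tm p < a + h)%R) s <= D)%N) ->
  (m * D < size s)%N ->
  exists x : nat -> T, (forall i, (i <= m)%N -> x i \in s) /\
    (forall i, (i < m)%N -> tm (x i) + h <= tm (x i.+1)).
Proof.
have exmin (r : seq T) : (0 < size r)%N ->
    exists2 p, p \in r & forall q, q \in r -> tm p <= tm q.
  elim: r => // p [|p' r] IH _.
    by exists p; rewrite ?mem_head // => q; rewrite inE => /eqP->.
  have [q qr qmin] := IH isT; have [pq|qp] := leP (tm p) (tm q).
    exists p; rewrite ?mem_head // => u; rewrite inE => /orP[/eqP->//|/qmin].
    exact: le_trans.
  exists q; first by rewrite inE qr orbT.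
  by move=> u; rewrite inE => /orP[/eqP->|/qmin//]; apply: ltW.
elim: m s => [|m IH] s sD ms.
  have [p ps _] := exmin s ms; exists (fun=> p); split=> // i.
have [p ps pmin] := exmin s (leq_ltn_trans (leq0n _) ms).
pose s' := [seq q <- s | tm p + h <= tm q].
have ms' : (m * D < size s')%N.
  move: ms; rewrite -(count_predC (fun q => tm p + h <= tm q) s) size_filter.
  rewrite mulSn addnC => ms; rewrite -(ltn_add2r D).
  apply: leq_trans ms _; rewrite leq_add2l.
  apply: leq_trans (sD (tm p)); rewrite (@eq_in_count _ _ (fun q =>
    (tm p <= tm q < tm p + h)%R)) // => q qs /=.
  by rewrite pmin // -ltNge.
have sD' a : (count (fun q => (a <= tm q < a + h)%R) s' <= D)%N.
  by apply: leq_trans (sD a); apply: leq_count_subseq; apply: filter_subseq.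
have [x [xs xsep]] := IH s' sD' ms'.
have mem_s i : (i <= m)%N -> tm p + h <= tm (x i) /\ x i \in s.
  by move=> im; have := xs i im; rewrite mem_filter => /andP.
exists (fun i => if i is j.+1 then x j else p); split=> [[|i] im|[|i] im] //.
- by have [] := mem_s i im.
- by have [] := mem_s 0%N isT.
- exact: xsep.
Qed.

(** Scaled by [N] and shifted by [r], the differences of coordinates with [p0] become natural
    numbers at most [2 * r], which determine the point. *)
Lemma size_lattice_box (R : realType) (N r : nat) (p0 : R * R)
    (s : seq (R * R)) : (0 < N)%N -> uniq s ->
  lattice N p0 -> (forall p, p \in s -> lattice N p) ->
  (forall p, p \in s ->
     `|p.1 - p0.1| <= r%:R / N%:R /\ `|p.2 - p0.2| <= r%:R / N%:R) ->
  (size s <= r.*2.+1 ^ 2)%N.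
Proof.
move=> N0 us lp0 ls bs.
have NR0 : 0 < N%:R :> R by rewrite ltr0n.
pose c (x y : R) := N%:R * (x - y) + r%:R.
have c_nat (a b : int) :
    `|a%:~R / N%:R - b%:~R / N%:R| <= r%:R / N%:R :> R ->
    c (a%:~R / N%:R) (b%:~R / N%:R) \is a Num.nat /\
    c (a%:~R / N%:R) (b%:~R / N%:R) < (r.*2.+1)%:R.
  rewrite -mulrBl normrM [ `|N%:R^-1|]gtr0_norm ?invr_gt0 //.
  rewrite ler_pM2r ?invr_gt0 // /c -mulrBl mulrCA divff ?gt_eqF // mulr1.
  rewrite ler_norml => /andP[lo hi]; split; last first.
    by rewrite -addnn -natr1 natrD; lra.
  rewrite natrEint; apply/andP; split; last by lra.
  by rewrite rpredD ?rpredB ?rpred_int // rpred_nat.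
pose f (p : R * R) : 'I_(r.*2.+1) * 'I_(r.*2.+1) :=
  (inord (Num.truncn (c p.1 p0.1)), inord (Num.truncn (c p.2 p0.2))).
have [a0 [b0 E0]] := lp0.
have c_s p : p \in s -> [/\ c p.1 p0.1 \is a Num.nat,
    c p.1 p0.1 < (r.*2.+1)%:R, c p.2 p0.2 \is a Num.nat
    & c p.2 p0.2 < (r.*2.+1)%:R].
  move=> ps; have [h1 h2] := bs p ps; have [a [b E]] := ls p ps.
  by move: h1 h2; rewrite E E0 /= => /c_nat[-> ->] /c_nat[-> ->].
have tr_inj x y : x \is a Num.nat -> y \is a Num.nat ->
    x < (r.*2.+1)%:R -> y < (r.*2.+1)%:R ->
    (inord (Num.truncn x) : 'I_(r.*2.+1)) = inord (Num.truncn y) -> x = y :> R.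
  move=> xn yn xr yr /(congr1 val); rewrite /= !inordK.
  - by move=> E; rewrite -(truncnK xn) E truncnK.
  - by rewrite -(ltr_nat R) truncnK.
  - by rewrite -(ltr_nat R) truncnK.
have finj : {in s &, injective f}.
  move=> p q ps qs [Ep Eq].
  have [p1 p1' p2 p2'] := c_s p ps; have [q1 q1' q2 q2'] := c_s q qs.
  have := tr_inj _ _ p1 q1 p1' q1' Ep; have := tr_inj _ _ p2 q2 p2' q2' Eq.
  move=> /addIr/(mulfI (lt0r_neq0 NR0))/addIr e2.
  move=> /addIr/(mulfI (lt0r_neq0 NR0))/addIr e1.
  by case: (p) (q) e1 e2 => [? ?] [? ?] /= -> ->.
have uf : uniq (map f s) by rewrite map_inj_in_uniq.
rewrite -(size_map f) -(card_uniqP uf); apply: leq_trans (max_card _) _.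
by rewrite card_prod card_ord mulnn.
Qed.

(** * Determinants of monomials at lattice points *)

Lemma monomial_eval_lattice (R : realType) (N : nat) (m : monomial)
    (p : R * R) :
  (0 < N)%N -> lattice N p ->
  exists z : int, monomial_eval m p * N%:R ^+ mdegree m = z%:~R.
Proof.
move=> N0 [a [b ->]]; exists (a ^+ m.1 * b ^+ m.2).
have NR0 : N%:R != 0 :> R by rewrite pnatr_eq0 -lt0n.
rewrite /monomial_eval /mdegree /= !expr_div_n exprD rmorphM !rmorphXn /=.
by field; rewrite !expf_neq0.
Qed.

(** Scaling column [j] by [N] to the degree of [m j] clears denominators, and an integer of absolute
    value less than 1 is 0. *)
Lemma det_lattice_eq0 (R : realType) (n N : nat) (m : 'I_n -> monomial)
    (p : 'I_n -> R * R) : (0 < N)%N -> (forall i, lattice N (p i)) ->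
  `|\det (\matrix_(i, j) monomial_eval (m j) (p i))|
     * N%:R ^+ (\sum_j mdegree (m j)) < 1 ->
  \det (\matrix_(i, j) monomial_eval (m j) (p i)) = 0.
Proof.
move=> N0 lp; set X := \matrix_(i, j) _ => small.
have zex (ij : 'I_n * 'I_n) : exists z : int,
    monomial_eval (m ij.2) (p ij.1) * N%:R ^+ mdegree (m ij.2) = z%:~R.
  exact: monomial_eval_lattice.
have [z zE] := choice zex.
pose Z := \matrix_(i < n, j < n) z (i, j).
have E : X *m diag_mx (\row_j N%:R ^+ mdegree (m j)) = map_mx intr Z.
  apply/matrixP => i j; rewrite mul_mx_diag !mxE; exact: (zE (i, j)).
have := congr1 determinant E; rewrite det_mulmx det_diag det_map_mx.
rewrite (eq_bigr (fun j => N%:R ^+ mdegree (m j))); last first.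
  by move=> j _; rewrite mxE.
rewrite -expr_sum => dE.
have NR0 : N%:R != 0 :> R by rewrite pnatr_eq0 -lt0n.
have : `|(\det Z)%:~R : R| < 1.
  by rewrite -dE normrM [ `|_ ^+ _|]ger0_norm ?exprn_ge0.
rewrite -intr_norm ltrz1 => dZ.
have {}dZ : \det Z = 0 by move: (\det Z) dZ; lia.
move: dE; rewrite dZ => /eqP; rewrite mulf_eq0 expf_eq0 (negPf NR0).
by rewrite andbF orbF => /eqP.
Qed.

(** Taylor expansion at [t0] splits every entry into [n + 1] terms. Those of index [k < n] have
    coefficients common to all rows; index [n] collects the Taylor remainder and the distance from
    the curve, both of order [l ^ n]. So [norm_det_flag_le] makes the determinant small, and
    integrality concludes. *)
Lemma det_window_eq0 (R : realType) (n N : nat) (b K K' l t0 : R)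
    (m : 'I_n.+1 -> monomial) (gamma : R -> R * R)
    (p : 'I_n.+1 -> R * R) (t : 'I_n.+1 -> R) :
  (0 < N)%N -> 0 < l -> l <= 1 -> 0 <= K' -> t0 \in `[0, 1] ->
  (forall j, smooth01 b n K (fun u => monomial_eval (m j) (gamma u))) ->
  (forall i, lattice N (p i)) -> (forall i, t i \in `[0, 1]) ->
  (forall i, `|t i - t0| <= l) ->
  (forall i j, `|monomial_eval (m j) (p i) - monomial_eval (m j) (gamma (t i))|
     <= K' * l ^+ n) ->
  (n.+1 ^ n.+1)%:R * ((n.+1)`!%:R * (K + K') ^+ n.+1) * l ^+ (\sum_(k < n.+1) k)
    * N%:R ^+ (\sum_j mdegree (m j)) < 1 ->
  \det (\matrix_(i, j) monomial_eval (m j) (p i)) = 0.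
Proof.
move=> N0 l0 l1 K'0 t001 sm lp t01 tl pe small.
apply: (det_lattice_eq0 N0) => //.
apply: le_lt_trans small; rewrite ler_wpM2r ?exprn_ge0 ?ler0n //.
pose f j u := monomial_eval (m j) (gamma u).
pose T i j := \sum_(k < n) (t i - t0) ^+ k * (derive01n k (f j) t0 / k`!%:R).
(* The last term is normalised by [l ^ n], so that [c i k] is at most [l ^ k] and the coefficients
   [a i k j] at most [K + K'] in absolute value. *)
pose c (i k : 'I_n.+1) := if (k < n)%N then (t i - t0) ^+ k else l ^+ n.
pose a (i k j : 'I_n.+1) := if (k < n)%N then derive01n k (f j) t0 / k`!%:R
  else (monomial_eval (m j) (p i) - T i j) / l ^+ n.
have K0 : 0 <= K by have [_ /(_ 0%N isT)/hoelder_bounded_ge0] := sm ord0.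
have -> : \matrix_(i, j) monomial_eval (m j) (p i) =
    \matrix_(i, j) \sum_k c i k * a i k j.
  apply/matrixP => i j; rewrite !mxE big_ord_recr /= /c /a /= ltnn.
  rewrite [l ^+ n * _]mulrC divfK ?expf_neq0 ?gt_eqF //.
  rewrite (eq_bigr (fun k : 'I_n =>
    (t i - t0) ^+ k * (derive01n k (f j) t0 / k`!%:R))).
    by rewrite addrC subrK.
  by move=> k _; rewrite ltn_ord.
apply: norm_det_flag_le.
- by rewrite ltW.
- move=> i k; rewrite /c; case: ltnP => kn.
    by rewrite normrX lerXn2r ?nnegrE // ltW.
  have -> : k = n :> nat by apply/eqP; rewrite eqn_leq kn -ltnS ltn_ord.
  by rewrite ger0_norm // exprn_ge0 // ltW.
- move=> i k j; rewrite /a; case: ltnP => kn.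
    apply: le_trans (_ : K <= _); last by rewrite lerDl.
    rewrite normrM normfV [ `|_%:R|]ger0_norm ?ler0n //.
    have [_ /(_ k (ltnW kn))/(_ t0 t0 t001 t001)[kb _]] := sm j.
    rewrite ler_pdivrMr ?ltr0n ?fact_gt0 //; apply: le_trans kb _.
    by rewrite ler_peMr // ler1n fact_gt0.
  rewrite normrM normfV [ `|l ^+ n|]ger0_norm; last by rewrite exprn_ge0 // ltW.
  rewrite ler_pdivrMr ?exprn_gt0 // mulrDl [leRHS]addrC.
  have -> : monomial_eval (m j) (p i) - T i j =
      (monomial_eval (m j) (p i) - f j (t i)) + (f j (t i) - T i j).
    by rewrite addrA subrK.
  apply: le_trans (ler_normD _ _) _; apply: lerD; first exact: pe.
  apply: le_trans (_ : K * `|t i - t0| ^+ n <= _); last first.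
    by rewrite ler_wpM2l // lerXn2r ?nnegrE // ltW.
  apply: (@taylor01_bound _ n (fun k => derive01n k (f j))) => //.
    by move=> k' kn'; apply: (smooth01_has_deriv (sm j)).
  by move=> s s01; have [_ /(_ n (leqnn n))/(_ s s s01 s01)[]] := sm j.
- by move=> i i' k j kn; rewrite /a kn.
Qed.

(** * Many separated points against the Wronskian bound *)

(** The [if] carries the constant term at order 0 and drops it afterwards; one formula then covers
    all orders, as [small_derivative_of_separated] requires. *)
Lemma has_deriv01_comb (R : realType) (b K v0 : R) (n k : nat)
    (v : 'I_n -> R) (f : 'I_n -> R -> R) : (k < n)%N ->
  (forall j, smooth01 b n K (f j)) ->
  has_deriv01
    (fun t => (if k == 0 then v0 else 0) + \sum_j v j * derive01n k (f j) t)
    (fun t => (if k.+1 == 0 then v0 else 0)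
       + \sum_j v j * derive01n k.+1 (f j) t).
Proof.
move=> kn sm; apply: has_deriv01D; first exact: has_deriv01_cst.
apply: has_deriv01_sum => j; apply: has_deriv01Z.
exact: smooth01_has_deriv (sm j) kn.
Qed.

(** The pair [(0, 0)] is the constant monomial 1. It gives the column of ones in the determinants
    and disappears upon differentiation, so that only [M] enters the Wronskian. *)
Definition mon1 (n : nat) (M : n.-tuple monomial) (j : 'I_n.+1) : monomial :=
  tnth [tuple of (0%N, 0%N) :: M] j.

(** Vanishing minors give one combination of 1 and the monomials of [M] that is zero at all the
    points, hence small along the curve at [2 ^ n] separated times. Its derivatives are then small
    at [t0], and inverting the Wronskian matrix bounds the largest coefficient [mu] by less than
    [mu]. *)
Lemma no_separated_points (R : realType) (n : nat) (M : n.-tuple monomial)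
    (gamma : R -> R * R) (b K c0 h e l t0 t1 : R)
    (p : nat -> R * R) (t : nat -> R) :
  (0 < n)%N -> 0 < c0 -> 0 < h -> 0 <= b -> t0 \in `[0, 1] -> t1 \in `[0, 1] ->
  t1 - t0 <= l ->
  (forall j, smooth01 b n K (fun u => monomial_eval (tnth M j) (gamma u))) ->
  c0 < Wdet M gamma t0 ->
  (forall i, (i < 2 ^ n)%N -> t0 <= t i <= t1) ->
  (forall i, (i.+1 < 2 ^ n)%N -> t i + h <= t i.+1) ->
  (forall i j, (i < 2 ^ n)%N ->
     `|monomial_eval (tnth M j) (p i) - monomial_eval (tnth M j) (gamma (t i))|
       <= e) ->
  (forall g : 'I_n.+1 -> 'I_(2 ^ n),
     \det (\matrix_(i, j) monomial_eval (mon1 M j) (p (g i))) = 0) ->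
  (forall k, (0 < k <= n)%N ->
     n%:R * (n.-1`!%:R * K ^+ n.-1) *
       (n%:R * (e * (2 / h) ^+ k + K * l `^ b)) / c0 < 1) -> False.
Proof.
move=> n0 c00 h0 b0 t001 t101 tl sm Wc tin tsep pe minors small.
pose X := \matrix_(i < 2 ^ n, j < n.+1) monomial_eval (mon1 M j) (p i).
have [v v0 Xv] : exists2 v : 'cV[R]_n.+1, v != 0 & X *m v = 0.
  apply: exists_kernel_of_minors => g; rewrite -[RHS](minors g).
  by congr (\det _); apply/matrixP => i j; rewrite !mxE.
pose w (j : 'I_n) := v (lift ord0 j) 0.
pose f (j : 'I_n) u := monomial_eval (tnth M j) (gamma u).
have Pp i : (i < 2 ^ n)%N ->
    v ord0 0 + \sum_j w j * monomial_eval (tnth M j) (p i) = 0.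
  move=> ilt; have /matrixP/(_ (Ordinal ilt) 0) := Xv.
  rewrite !mxE big_ord_recl mxE /mon1 tnth0.
  have -> : monomial_eval (0%N, 0%N) (p (Ordinal ilt)) = 1.
    by rewrite /monomial_eval /= !expr0 mulr1.
  rewrite mul1r => E; rewrite -[RHS]E.
  by congr (_ + _); apply: eq_bigr => j _; rewrite !mxE /mon1 tnthS mulrC.
have [j0 _ jmax] := @arg_maxP _ _ _ (Ordinal n0) xpredT (fun j => `|w j|) isT.
pose mu : R := `|w j0|.
have {}jmax j : `|w j| <= mu := jmax j isT.
(* If all coefficients of [M] were 0, so would be the constant one, by vanishing at [p 0]. *)
have mu0 : 0 < mu.
  rewrite /mu normr_gt0; apply/eqP => w0.
  have wz j : w j = 0.
    by apply/eqP; rewrite -normr_le0; have := jmax j; rewrite /mu w0 normr0.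
  have := Pp 0%N; rewrite expn_gt0 big1 => [/(_ isT)|j _]; last first.
    by rewrite wz mul0r.
  rewrite addr0 => vz; case/eqP: v0; apply/matrixP => i j; rewrite ord1 !mxE.
  by case: (unliftP ord0 i) => [i' ->|->]; [exact: wz|].
have K0 : 0 <= K.
  by have [_ /(_ 0%N isT)/hoelder_bounded_ge0] := sm (Ordinal n0).
have sum_le (x : 'I_n -> R) (y : R) : (forall j, `|x j| <= y) ->
    `|\sum_j w j * x j| <= n%:R * mu * y.
  move=> xy; apply: le_trans (ler_norm_sum _ _ _) _.
  have -> : n%:R * mu * y = \sum_(j < n) mu * y.
    by rewrite sumr_const card_ord -[RHS]mulr_natl mulrA.
  by apply: ler_sum => j _; rewrite normrM ler_pM // jmax.
pose F k u := (if k == 0%N then v ord0 0 else 0)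
  + \sum_j w j * derive01n k (f j) u.
have FF k : (k < n)%N -> has_deriv01 (F k) (F k.+1).
  by move=> kn; apply: has_deriv01_comb sm.
have Fp i : (i < 2 ^ n)%N -> t0 <= t i <= t1 /\ `|F 0%N (t i)| <= n%:R * mu * e.
  move=> ilt; split; first exact: tin.
  rewrite -[F 0%N (t i)]subr0 -(Pp i ilt) /F /= opprD addrACA subrr add0r.
  rewrite -sumrB; under eq_bigr do rewrite -mulrBr.
  by apply: sum_le => j; rewrite distrC; apply: pe.
(* The mean value theorem bounds the derivative at some [y] of the window; Hoelder continuity moves
   the bound to [t0], which adds the term with exponent [b]. *)
have Fsmall (k : nat) : (0 < k <= n)%N ->
    `|F k t0| <= mu * (n%:R * (e * (2 / h) ^+ k + K * l `^ b)).
  move=> /andP[k0 kn].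
  have [y /andP[y0 y1] Fy] :=
    small_derivative_of_separated h0 t001 t101 FF Fp tsep kn.
  have y01 : y \in `[0, 1] by move: t001 t101; rewrite !in_itv /=; lra.
  rewrite -[F k t0](subrK (F k y)); apply: le_trans (ler_normD _ _) _.
  have -> : mu * (n%:R * (e * (2 / h) ^+ k + K * l `^ b)) =
    n%:R * mu * (K * l `^ b) + n%:R * mu * e * (2 / h) ^+ k by ring.
  apply: lerD => //; rewrite /F gtn_eqF // !add0r -sumrB.
  under eq_bigr do rewrite -mulrBr.
  apply: sum_le => j; have [_ /(_ k kn)/(_ t0 y t001 y01)[_]] := sm j.
  move/le_trans; apply; rewrite ler_wpM2l // ge0_ler_powR ?nnegrE //.
    by lra.
  by rewrite ler0_norm; lra.
pose W := \matrix_(i < n, j < n) derive01n i.+1 (f j) t0.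
pose wv := \col_j w j.
have Ww i : (W *m wv) i 0 = F i.+1 t0.
  by rewrite mxE /F /= add0r; apply: eq_bigr => j _; rewrite !mxE mulrC.
have WK i j : `|W i j| <= K.
  by rewrite mxE; have [_ /(_ i.+1 (ltn_ord i))/(_ t0 t0 t001 t001)[]] := sm j.
(* All rows need a common bound: the largest of the bounds for the orders 1 to [n]. *)
have mx_le (i : 'I_n) : exists i' : 'I_n, forall j : 'I_n,
   `|(W *m wv) j 0| <= mu * (n%:R * (e * (2 / h) ^+ i'.+1 + K * l `^ b)).
  have [i' _ imax] := @arg_maxP _ _ _ i xpredT
    (fun k : 'I_n => mu * (n%:R * (e * (2 / h) ^+ k.+1 + K * l `^ b))) isT.
  exists i' => j; rewrite Ww; apply: le_trans (imax j isT).
  by apply: Fsmall; rewrite /= ltn_ord.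
have [i' Wle] := mx_le j0.
have := norm_coef_le_of_det_ge c00 (ltW Wc) WK Wle j0.
rewrite mxE -/mu => /le_lt_trans.
have := small i'.+1; rewrite /= ltn_ord => /(_ isT) lt1.
have /= := ltr_pM2l mu0 (n%:R * (n.-1`!%:R * K ^+ n.-1) *
       (n%:R * (e * (2 / h) ^+ i'.+1 + K * l `^ b)) / c0) 1.
rewrite lt1 mulr1 => lt2 /(_ mu); rewrite ltxx => C.
suff : false by []; apply: C; apply: le_lt_trans lt2; rewrite le_eqVlt.
by apply/orP; left; apply/eqP; field; rewrite gt_eqF.
Qed.

(** * Counting nearby lattice points by windows of time *)

(** Lists replace sets so that counting can precede finiteness; [tm p] is a chosen time at which the
    curve is close to [p], coordinate by coordinate. *)
Definition near_curve (R : realType) (N : nat) (delta : R)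
    (gamma : R -> R * R) (tm : R * R -> R) (s : seq (R * R)) : Prop :=
  uniq s /\ forall p, p \in s ->
    [/\ lattice N p, tm p \in `[0, 1], `|p.1 - (gamma (tm p)).1| <= delta
      & `|p.2 - (gamma (tm p)).2| <= delta].

(** Points with times at most [B / N] apart differ by at most [(2 * d + A * B) / N] in each
    coordinate, through their distances to the curve and its Lipschitz bound; so all lie in a box
    around any one of them. *)
Lemma count_time_window (R : realType) (N r : nat) (A d B : R)
    (gamma : R -> R * R) (tm : R * R -> R) (s : seq (R * R)) :
  (0 < N)%N -> 0 <= A -> near_curve N (d / N%:R) gamma tm s ->
  (forall t u : R, t \in `[0, 1] -> u \in `[0, 1] ->
     `|(gamma t).1 - (gamma u).1| <= A * `|t - u| /\
     `|(gamma t).2 - (gamma u).2| <= A * `|t - u|) ->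
  2 * d + A * B <= r%:R ->
  forall a, (count (fun p => (a <= tm p < a + B / N%:R)%R) s <= r.*2.+1 ^ 2)%N.
Proof.
move=> N0 A0 [us sP] lip dr a; rewrite -size_filter.
set s' := seq.filter _ s; case E : s' => [//|p0 s'']; rewrite -E.
have NR0 : 0 < N%:R :> R by rewrite ltr0n.
have mem p : p \in s' -> p \in s /\ a <= tm p < a + B / N%:R.
  by rewrite mem_filter => /andP[].
have [p0s p0a] : p0 \in s /\ a <= tm p0 < a + B / N%:R.
  by apply: mem; rewrite E mem_head.
have [lp0 t0 x0 y0] := sP _ p0s.
apply: (size_lattice_box N0 (p0 := p0)) => //; first exact: filter_uniq.
  by move=> p /mem[/sP[]].
have triangle (u v u' v' D : R) : `|u - u'| <= d / N%:R ->
    `|v - v'| <= d / N%:R -> `|u' - v'| <= A * D -> D <= B / N%:R ->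
    `|u - v| <= r%:R / N%:R.
  move=> h1 h2 h3 hD.
  have -> : u - v = (u - u') + (u' - v') - (v - v') by ring.
  apply: le_trans (ler_normB _ _) _.
  apply: le_trans (lerD (ler_normD _ _) (lexx _)) _.
  apply: le_trans (_ : (2 * d + A * B) / N%:R <= _); last first.
    by rewrite ler_pM2r ?invr_gt0.
  have : A * D <= A * (B / N%:R) by rewrite ler_wpM2l.
  have -> : (2 * d + A * B) / N%:R =
    d / N%:R + A * (B / N%:R) + d / N%:R by ring.
  lra.
move=> p /mem[/sP[lp t x y] pa].
have D : `|tm p - tm p0| <= B / N%:R by rewrite ler_norml; lra.
have [l1 l2] := lip _ _ t t0.
by split; [apply: triangle x x0 l1 D|apply: triangle y y0 l2 D].
Qed.

(** Otherwise [m + 1] times separated by [h] would fit in [0, 1], although [m * h > 1]. *)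
Lemma size_le_of_time_windows (R : realType) (T : eqType) (tm : T -> R) (h : R)
    (D m : nat) (s : seq T) :
  (forall p, p \in s -> tm p \in `[0, 1]) ->
  (forall a, (count (fun p => (a <= tm p < a + h)%R) s <= D)%N) ->
  1 < m%:R * h -> (size s <= m * D)%N.
Proof.
move=> s01 sD mh; rewrite leqNgt.
apply/negP => /(exists_separated sD)[x [xs xsep]].
have len i : (i <= m)%N -> tm (x 0%N) + i%:R * h <= tm (x i).
  elim: i => [|i IH] im; first by rewrite mul0r addr0.
  apply: le_trans (xsep i im); rewrite -natr1 mulrDl mul1r addrA lerD2r.
  exact: IH (ltnW im).
have := len m (leqnn m).
have := s01 _ (xs m (leqnn m)); have := s01 _ (xs 0%N (leq0n m)).
by rewrite !in_itv /=; lra.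
Qed.

(** An infinite set would contain finite subsets of size greater than [X], so the bound on lists
    yields finiteness as well. *)
Lemma finite_set_of_uniq_seqs (R : realType) (T : choiceType) (S : set T)
    (X : R) :
  (forall s : seq T, uniq s -> (forall p, p \in s -> S p) ->
     (size s)%:R <= X) ->
  finite_set S /\ (#|` fset_set S |%fset)%:R <= X.
Proof.
move=> bnd; have fS : finite_set S.
  apply: contrapT => /infinite_set_fset => /(_ (Num.truncn X).+1)[B BS cB].
  have := bnd (enum_fset B) (fset_uniq B) (fun p pB => BS p pB).
  have := truncnS_gt X; rewrite -(ler_nat R) in cB.
  by move=> h1 h2; move: (le_trans cB h2); rewrite leNgt h1.
split=> //; apply: (bnd (enum_fset (fset_set S))); first exact: fset_uniq.
by move=> p; rewrite in_fset_set // => /set_mem.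
Qed.

Lemma sum_mdegree_mon1 (n : nat) (M : n.-tuple monomial) :
  (\sum_(j < n.+1) mdegree (mon1 M j) = \sum_(m <- M) mdegree m)%N.
Proof.
rewrite big_ord_recl /mon1 tnth0 add0n big_tuple.
by apply: eq_bigr => j _; rewrite tnthS.
Qed.

Lemma mdegree_le_sum (n : nat) (M : n.-tuple monomial) (j : 'I_n) :
  (mdegree (tnth M j) <= \sum_(m <- M) mdegree m)%N.
Proof. by rewrite big_tuple (bigD1 j) //= leq_addr. Qed.

(** With more than [2 ^ n * D2] points in a window, the greedy choice finds [2 ^ n] of them
    separated by [h]; [det_window_eq0] makes their minors vanish and [no_separated_points] applies.
    The two smallness hypotheses serve these lemmas in turn. *)
Lemma count_window_le (R : realType) (n N Dg D2 : nat) (M : n.-tuple monomial)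
    (gamma : R -> R * R) (tm : R * R -> R) (s : seq (R * R))
    (delta b K K' c0 h e l : R) :
  (0 < n)%N -> (0 < N)%N -> near_curve N delta gamma tm s ->
  0 < c0 -> 0 < h -> 0 <= b -> 0 < l -> l <= 1 -> 0 <= K' ->
  (forall m, (mdegree m <= Dg)%N ->
     smooth01 b n K (fun u => monomial_eval m (gamma u))) ->
  (forall m p, (mdegree m <= Dg)%N -> p \in s ->
     `|monomial_eval m p - monomial_eval m (gamma (tm p))| <= e) ->
  e <= K' * l ^+ n ->
  (\sum_(m <- M) mdegree m <= Dg)%N ->
  (forall t, t \in `[0, 1] -> c0 < Wdet M gamma t) ->
  (forall a, (count (fun p => (a <= tm p < a + h)%R) s <= D2)%N) ->
  (n.+1 ^ n.+1)%:R * ((n.+1)`!%:R * (K + K') ^+ n.+1) * l ^+ (\sum_(k < n.+1) k)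
    * N%:R ^+ (\sum_(m <- M) mdegree m) < 1 ->
  (forall k, (0 < k <= n)%N ->
     n%:R * (n.-1`!%:R * K ^+ n.-1) *
       (n%:R * (e * (2 / h) ^+ k + K * l `^ b)) / c0 < 1) ->
  forall a, (count (fun p => (a <= tm p < a + l)%R) s <= 2 ^ n * D2)%N.
Proof.
move=> n0 N0 [us sP] c00 h0 b0 l0 l1 K'0 sm pe eK' MD Wc hD2 small1 small2 a.
rewrite leqNgt -size_filter; apply/negP; set s' := seq.filter _ s => big.
have hD2' c : (count (fun p => (c <= tm p < c + h)%R) s' <= D2)%N.
  by apply: leq_trans (hD2 c); apply: leq_count_subseq; apply: filter_subseq.
have [x [xs xsep]] := exists_separated hD2' big.
have xmem i : (i < 2 ^ n)%N -> x i \in s /\ a <= tm (x i) < a + l.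
  by move=> /ltnW/xs; rewrite mem_filter => /andP[].
have n20 : (0 < 2 ^ n)%N by rewrite expn_gt0.
have [x0s x0a] := xmem _ n20; have [_ tx0 _ _] := sP _ x0s.
(* The window may stick out of [0, 1]. Clipping loses none of the times, and the time of [x 0] shows
   that both ends stay in [0, 1]. *)
pose t0 := Num.max a 0; pose t1 := Num.min (a + l) 1.
have t01 : [/\ t0 \in `[0, 1], t1 \in `[0, 1] & t1 - t0 <= l].
  move: tx0 x0a; rewrite !in_itv /= /t0 /t1.
  by case: (leP a 0); case: (leP (a + l) 1); split; lra.
have [t001 t101 tl] := t01.
have tin i : (i < 2 ^ n)%N -> t0 <= tm (x i) <= t1.
  move=> /xmem[xis xia]; have [_ txi _ _] := sP _ xis.
  move: xia txi; rewrite in_itv /= ge_max le_min; lra.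
have degM j : (mdegree (tnth M j) <= Dg)%N.
  exact: leq_trans (mdegree_le_sum M j) MD.
have deg1 j : (mdegree (mon1 M j) <= Dg)%N.
  case: (unliftP ord0 j) => [j' ->|->]; rewrite /mon1 ?tnthS //.
apply: (@no_separated_points _ n M gamma b K c0 h e l t0 t1 x (tm \o x)) => //.
- by move=> j; apply: sm.
- exact: Wc.
- by move=> i /ltnW; apply: xsep.
- by move=> i j /xmem[xis _]; apply: pe.
move=> g; apply: (@det_window_eq0 _ n N b K K' l t0 (mon1 M) gamma
  (x \o g) (tm \o x \o g)) => //.
- by move=> j; apply: sm.
- by move=> i; have [/sP[]] := xmem _ (ltn_ord (g i)).
- by move=> i; have [/sP[]] := xmem _ (ltn_ord (g i)).
- move=> i /=; have := tin _ (ltn_ord (g i)) => ti.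
  by rewrite ger0_norm; lra.
- move=> i j /=; have [xis _] := xmem _ (ltn_ord (g i)).
  exact: le_trans (pe _ _ (deg1 j) xis) eK'.
by rewrite sum_mdegree_mon1.
Qed.

(** * Choice of the window length and of the constants *)

(** This is where the exponent [eexp M] comes from: the powers 0 to [n] add up to [n(n+1)/2], so the
    degrees cancel exactly and only the saving from [eps] remains. *)
Lemma window_power (R : realType) (n N : nat) (M : n.-tuple monomial)
    (eps : R) :
  (0 < n)%N -> (0 < N)%N ->
  (N%:R `^ (- (eexp M + eps))) ^+ (\sum_(k < n.+1) k)
    * N%:R ^+ (\sum_(m <- M) mdegree m)
  = N%:R `^ (- (eps * (\sum_(k < n.+1) k)%N%:R)) :> R.
Proof.
move=> n0 N0; have NR0 : 0 < N%:R :> R by rewrite ltr0n.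
rewrite -!powR_mulrn ?powR_ge0 ?ler0n // -powRrM -powRD; last first.
  by rewrite (gt_eqF NR0) implybT.
congr (_ `^ _); rewrite /eexp; set deg := (\sum_(m <- M) _)%N.
have -> : (\sum_(k < n.+1) k)%N%:R = n%:R * n.+1%:R / 2 :> R.
  elim: n {M n0 deg} => [|n IH].
    by rewrite big_ord_recr big_ord0 /= !mul0r.
  by rewrite big_ord_recr /= natrD IH -!natr1; field.
have n1 : n%:R != 0 :> R by rewrite pnatr_eq0 -lt0n.
have n2 : n.+1%:R != 0 :> R by rewrite pnatr_eq0.
move: (n.+1%:R : R) n2 => m m0.
by field; rewrite m0 n1.
Qed.

Lemma eexp_ge0 (R : realType) (n : nat) (M : n.-tuple monomial) :
  0 <= eexp M :> R.
Proof. by rewrite mulr_ge0 ?divr_ge0 ?mulr_ge0 ?ler0n. Qed.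

Lemma sum_mdegree_le_of_eexp (R : realType) (n : nat) (M : n.-tuple monomial) :
  (0 < n)%N -> eexp M < 1 :> R -> (\sum_(m <- M) mdegree m <= n * n.+1)%N.
Proof.
move=> n0; rewrite /eexp mulrAC ltr_pdivrMr; last by rewrite mulr_gt0 ?ltr0n.
by rewrite mul1r -!natrM ltr_nat; lia.
Qed.

(** Since [k <= n], the powers of [N] contribute a factor at most 1 and leave [(2 / B) ^ k], which
    is at most [2 / B] because [k >= 1] and [B >= 2]. *)
Lemma separated_error_le (R : realType) (n N k : nat) (K' B : R) :
  (0 < N)%N -> 0 <= K' -> 2 <= B -> (0 < k <= n)%N ->
  K' / N%:R ^+ n * (2 / (B / N%:R)) ^+ k <= K' * (2 / B).
Proof.
move=> N0 K'0 B2 /andP[k0 kn]; have NR0 : 0 < N%:R :> R by rewrite ltr0n.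
have B0 : 0 < B by apply: lt_le_trans B2.
rewrite -mulrA ler_wpM2l //.
have -> : 2 / (B / N%:R) = 2 / B * N%:R :> R by field; rewrite !gt_eqF.
rewrite exprMn mulrC -mulrA.
have r1 : 0 <= 2 / B <= 1.
  by rewrite divr_ge0 ?(ltW B0) //= ler_pdivrMr // mul1r.
have [r0 r1'] := andP r1.
apply: le_trans (_ : (2 / B) ^+ k * 1 <= _).
  rewrite ler_wpM2l ?exprn_ge0 // ler_pdivrMr ?exprn_gt0 // mul1r.
  by rewrite ler_weXn2l // ler1n.
rewrite mulr1; case: k k0 {kn} => // k _.
by rewrite exprS ler_piMr // exprn_ile1.
Qed.

(** All constants are fixed before [gamma], [M] and [N], as the uniformity of [C] demands. *)
Lemma near_curve_size_le (R : realType) (n : nat) (alpha c0 d A eps : R) :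
  (0 < n)%N -> 0 < alpha -> 0 < c0 -> 0 < d -> 0 < eps ->
  exists C : R, forall (gamma : R -> R * R) (M : n.-tuple monomial),
    CnHoelder n alpha gamma ->
    CnHoelder_norm n alpha gamma <= A ->
    (forall t : R, t \in `[0, 1] -> c0 < Wdet M gamma t) ->
    forall (N : nat) (tm : R * R -> R) (s : seq (R * R)), (0 < N)%N ->
      near_curve N (d / N%:R ^+ n) gamma tm s ->
      (size s)%:R <= C * N%:R `^ (eexp M + eps).
Proof.
move=> n0 alpha0 c00 d0 eps0.
(* An exponent at most 1 lets Lipschitz bounds count as Hoelder bounds; [A' >= 1] makes powers
   monotone in the degree. *)
pose beta := Num.min alpha 1.
pose A' := Num.max A 1.
pose Dg := (n * n.+1)%N.
(* [K] controls all monomials of degree at most [Dg] along the curve, and [K' / N ^ n] their change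
   from the curve to a lattice point; [B1] bounds the coordinates of both. *)
pose K := 2 ^+ n.+1 * (2 ^+ n.+1 * A') ^+ Dg.
pose B1 := A' + d.
pose K' := 2 * Dg%:R * B1 ^+ Dg * d.
pose Cdet := (n.+1 ^ n.+1)%:R * ((n.+1)`!%:R * (K + K') ^+ n.+1).
pose Cw := n%:R * (n.-1`!%:R * K ^+ n.-1) * n%:R / c0.
(* The two contributions to the bound on the largest coefficient must each stay below 1/2: [B]
   handles the error at the points, [T] the Hoelder term. [T] also exceeds the determinant constant
   [Cdet]. *)
pose B := 2 + 4 * Cw * K'.
pose T := 2 * Cw * K + Cdet + 1.
(* An upper bound for [N] when [N] to the power [eps * beta] is below [T], a case left to the
   trivial bound. *)
pose N0 := T `^ (eps * beta)^-1.
pose r1 := (Num.truncn (2 * d + A' * 1)).+1.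
pose r2 := (Num.truncn (2 * d + A' * B)).+1.
pose D1 := (r1.*2.+1 ^ 2)%N.
pose D2 := (r2.*2.+1 ^ 2)%N.
have beta0 : 0 < beta by rewrite lt_min alpha0 ltr01.
have beta1 : beta <= 1 by rewrite ge_min lexx orbT.
have A'1 : 1 <= A' by rewrite le_max lexx orbT.
have A'0 : 0 <= A' by apply: le_trans A'1.
have K0 : 0 <= K by rewrite mulr_ge0 ?exprn_ge0 ?mulr_ge0 ?exprn_ge0.
have B11 : 1 <= B1 by rewrite /B1; lra.
have K'0 : 0 <= K'.
  by rewrite !mulr_ge0 ?ler0n ?exprn_ge0 ?(ltW d0) // (le_trans _ B11).
have Cdet0 : 0 <= Cdet by rewrite !mulr_ge0 ?ler0n ?exprn_ge0 ?addr_ge0.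
have Cw0 : 0 <= Cw by rewrite !mulr_ge0 ?ler0n ?exprn_ge0 ?invr_ge0 ?(ltW c00).
have CwK0 : 0 <= Cw * K by rewrite mulr_ge0.
have CwK'0 : 0 <= Cw * K' by rewrite mulr_ge0.
have B2 : 2 <= B by rewrite /B -mulrA; lra.
have T1 : 1 <= T by rewrite /T -mulrA; lra.
(* One term for each case: [eexp M + eps >= 1], bounded [N], and the determinant method. *)
exists (2 * D1%:R + 2 * N0 * D1%:R + 2 * (2 ^ n * D2)%:R).
move=> gamma M Cg Ag Wc N tm s N_gt0 nc.
have [sm1 sm2] := smooth01_curve alpha0 Cg Ag.
have {}sm1 : smooth01 beta n A' (fst \o gamma).
  by apply: smooth01_le sm1; rewrite // le_max lexx.
have {}sm2 : smooth01 beta n A' (snd \o gamma).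
  by apply: smooth01_le sm2; rewrite // le_max lexx.
have NR1 : 1 <= N%:R :> R by rewrite ler1n.
have NR0 : 0 < N%:R :> R by rewrite ltr0n.
have dN : d / N%:R ^+ n <= d / N%:R.
  rewrite ler_wpM2l ?(ltW d0) // lef_pV2 ?posrE ?exprn_gt0 //.
  by rewrite -[leLHS]expr1 ler_weXn2l.
have nc1 : near_curve N (d / N%:R) gamma tm s.
  have [us sP] := nc; split => // p /sP[lp tp h1 h2].
  by split=> //; [apply: le_trans h1 _|apply: le_trans h2 _].
have lip (t u : R) : t \in `[0, 1] -> u \in `[0, 1] ->
     `|(gamma t).1 - (gamma u).1| <= A' * `|t - u| /\
     `|(gamma t).2 - (gamma u).2| <= A' * `|t - u|.
  move=> t01 u01; split.
    apply: (has_deriv01_lipschitz (smooth01_has_deriv sm1 n0)) => // x x01.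
    by have [_ /(_ 1%N n0)/(_ x x x01 x01)[]] := sm1.
  apply: (has_deriv01_lipschitz (smooth01_has_deriv sm2 n0)) => // x x01.
  by have [_ /(_ 1%N n0)/(_ x x x01 x01)[]] := sm2.
have tm01 p : p \in s -> tm p \in `[0, 1] by have [_ sP] := nc; move=> /sP[].
set e' := eexp M + eps.
have e'0 : 0 < e' by rewrite ltr_wpDl // eexp_ge0.
have Ne'1 : 1 <= N%:R `^ e'.
  by rewrite -[leLHS](powRr0 (N%:R : R)) ler_powR // ltW.
(* Windows of length [1 / N]; taking [N + 1] of them makes their total length exceed 1 strictly. *)
have trivial_bound : (size s)%:R <= 2 * N%:R * D1%:R :> R.
  have cnt : forall a,
      (count (fun p => (a <= tm p < a + 1 / N%:R)%R) s <= D1)%N.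
    apply: count_time_window N_gt0 A'0 nc1 lip _.
    exact: ltW (truncnS_gt _).
  have := @size_le_of_time_windows _ _ tm _ _ N.+1 s tm01 cnt.
  rewrite mulrA mulr1 -natr1 ltr_pdivlMr // mul1r ltrDl ltr01 => /(_ isT).
  rewrite -(ler_nat R) natrM => /le_trans; apply.
  by rewrite ler_wpM2r ?ler0n // -natr1; lra.
have N00 : 0 <= N0 by rewrite powR_ge0.
have D10 : 0 <= D1%:R :> R by rewrite ler0n.
have D20 : 0 <= (2 ^ n * D2)%:R :> R by rewrite ler0n.
have X0 : 0 <= N%:R `^ e' by rewrite powR_ge0.
have [e'1|e'1] := leP 1 e'.
  apply: le_trans trivial_bound _; rewrite mulrAC.
  apply: ler_pM; rewrite ?mulr_ge0 ?ler0n //; last first.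
    by rewrite -[leLHS]powRr1 ?ler0n // ler_powR.
  by rewrite -addrA lerDl addr_ge0 // !mulr_ge0.
have [NT|TN] := ltP (N%:R `^ (eps * beta)) T.
  have NN0 : N%:R <= N0.
    have eb0 : eps * beta != 0 by rewrite mulf_neq0 ?gt_eqF.
    have -> : N%:R = (N%:R `^ (eps * beta)) `^ (eps * beta)^-1 :> R.
      by rewrite -powRrM divff // powRr1 ?ler0n.
    rewrite ge0_ler_powR ?nnegrE ?powR_ge0 ?(le_trans ler01 T1) ?(ltW NT) //.
    by rewrite invr_ge0 mulr_ge0 // ltW.
  apply: le_trans trivial_bound _.
  apply: le_trans (_ : 2 * N0 * D1%:R * 1 <= _).
    by rewrite mulr1 ler_wpM2r // ler_wpM2l.
  apply: ler_pM; rewrite ?mulr_ge0 //.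
  have : 0 <= 2 * D1%:R :> R by rewrite mulr_ge0.
  have : 0 <= 2 * (2 ^ n * D2)%:R :> R by rewrite mulr_ge0.
  lra.
pose l : R := N%:R `^ (- e').
have lE : l = (N%:R `^ e')^-1 by rewrite /l powRN.
have l0 : 0 < l by rewrite powR_gt0.
have l1 : l <= 1 by rewrite lE invf_le1 // powR_gt0.
(* This inequality serves twice: the determinant saves the exponent [eps * n(n+1)/2], at least
   [eps * beta], and the power [beta] of [l] saves [beta * e'], again at least [eps * beta]. *)
have q_le : N%:R `^ (- (eps * beta)) <= T^-1.
  by rewrite powRN lef_pV2 ?posrE ?powR_gt0 // (lt_le_trans _ T1).
(* Here [e' < 1] enters: windows are no shorter than [1 / N], so the distance to the curve is
   absorbed in [l ^ n]. *)
have lN : N%:R ^- n <= l ^+ n.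
  rewrite -exprVn lerXn2r ?nnegrE ?invr_ge0 ?ler0n ?(ltW l0) //.
  rewrite lE lef_pV2 ?posrE ?powR_gt0 //.
  by rewrite -[leRHS]powRr1 ?ler0n // ler_powR // ltW.
have MD : (\sum_(m <- M) mdegree m <= Dg)%N.
  apply: (@sum_mdegree_le_of_eexp R) => //.
  by apply: lt_trans e'1; rewrite ltrDl.
have cnt2 : forall a, (count (fun p => (a <= tm p < a + B / N%:R)%R) s <= D2)%N.
  apply: count_time_window N_gt0 A'0 nc1 lip _.
  exact: ltW (truncnS_gt _).
have cnt : forall a, (count (fun p => (a <= tm p < a + l)%R) s <= 2 ^ n * D2)%N.
  apply: (@count_window_le _ n N Dg D2 M gamma tm s (d / N%:R ^+ n) beta K K' c0
    (B / N%:R) (K' / N%:R ^+ n) l) => //.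
  - by rewrite divr_gt0 // (lt_le_trans _ B2).
  - exact: ltW.
  - by move=> m mD; apply: smooth01_monomial.
  - move=> m p mD ps; have [_ /(_ p ps)[_ tp h1 h2]] := nc.
    have [_ /(_ 0%N isT)/(_ _ _ tp tp)[/= g1 _]] := sm1.
    have [_ /(_ 0%N isT)/(_ _ _ tp tp)[/= g2 _]] := sm2.
    have dB : d / N%:R ^+ n <= d.
      by rewrite ler_pdivrMr ?exprn_gt0 // ler_peMr ?(ltW d0) // exprn_ege1.
    have pB (x y : R) : `|x - y| <= d / N%:R ^+ n -> `|y| <= A' -> `|x| <= B1.
      move=> h g; rewrite -[x](subrK y); apply: le_trans (ler_normD _ _) _.
      by rewrite /B1; lra.
    rewrite /K' -mulrA.
    apply: monomial_evalB_le => //.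
    + exact: pB h1 g1.
    + exact: pB h2 g2.
    + by rewrite /B1; apply: le_trans g1 _; lra.
    + by rewrite /B1; apply: le_trans g2 _; lra.
  - by rewrite ler_wpM2l.
  - rewrite -mulrA window_power //.
    apply: le_lt_trans (_ : Cdet * T^-1 < 1); last first.
      rewrite ltr_pdivrMr ?(lt_le_trans _ T1) // mul1r /T -mulrA; lra.
    rewrite ler_wpM2l //; apply: le_trans q_le; rewrite ler_powR // lerN2.
    rewrite ler_wpM2l ?(ltW eps0) //; apply: le_trans beta1 _.
    by rewrite ler1n big_ord_recr /= addn_gt0 n0 orbT.
  move=> k kn.
  have h1 := separated_error_le N_gt0 K'0 B2 kn.
  have h2 : l `^ beta <= T^-1.
    rewrite /l -powRrM mulNr; apply: le_trans q_le; rewrite ler_powR // lerN2.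
    by rewrite ler_wpM2r ?(ltW beta0) // lerDr eexp_ge0.
  have -> : n%:R * (n.-1`!%:R * K ^+ n.-1) * (n%:R * (K' / N%:R ^+ n *
      (2 / (B / N%:R)) ^+ k + K * l `^ beta)) / c0 =
      Cw * (K' / N%:R ^+ n * (2 / (B / N%:R)) ^+ k + K * l `^ beta).
    by rewrite /Cw; ring.
  apply: le_lt_trans (_ : Cw * (K' * (2 / B) + K * T^-1) < 1).
    by rewrite ler_wpM2l // lerD // ler_wpM2l.
  have -> : Cw * (K' * (2 / B) + K * T^-1) =
    Cw * K' * 2 / B + Cw * K / T by ring.
  have b1 : Cw * K' * 2 / B < 1 / 2.
    by rewrite ltr_pdivrMr ?(lt_le_trans _ B2) // /B -mulrA; lra.
  have b2 : Cw * K / T < 1 / 2.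
    by rewrite ltr_pdivrMr ?(lt_le_trans _ T1) // /T -mulrA; lra.
  lra.
(* At most [N ^ e' + 1 <= 2 * N ^ e'] windows are needed to exceed the length of [0, 1]. *)
have := @size_le_of_time_windows _ _ tm _ _ (Num.truncn (N%:R `^ e')).+1
  s tm01 cnt.
rewrite lE ltr_pdivlMr ?powR_gt0 // mul1r truncnS_gt => /(_ isT).
rewrite -(ler_nat R) natrM => /le_trans; apply.
have tr : (Num.truncn (N%:R `^ e'))%:R <= N%:R `^ e' by rewrite truncn_le.
rewrite mulrC; apply: le_trans (_ : 2 * (2 ^ n * D2)%:R * N%:R `^ e' <= _).
  rewrite [2 * _]mulrC -mulrA ler_wpM2l // -natr1; lra.
rewrite ler_wpM2r // lerDr addr_ge0 // !mulr_ge0 //.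
Qed.

Theorem theorem3p5 (R : realType) (n : nat) (alpha c0 d A eps : R)
    (halpha : 0 < alpha) (hc0 : 0 < c0) (hd : 0 < d) (heps : 0 < eps) :
  exists C : R, forall (gamma : R -> R * R) (M : n.-tuple monomial),
    CnHoelder n alpha gamma ->
    CnHoelder_norm n alpha gamma <= A ->
    uniq M -> (1%N, 0%N) \in M -> (0%N, 1%N) \in M ->
    (forall t : R, t \in `[0, 1] -> c0 < Wdet M gamma t) ->
    forall N : nat, (0 < N)%N ->
      let S := neighborhood (d / N%:R ^+ n) (curve gamma) `&` lattice N in
      finite_set S /\
      (#|` fset_set S |%fset)%:R <= C * N%:R `^ (eexp M + eps).
Proof.
(* The case [n = 0] is excluded by the presence of [x] in [M]. *)
have [n0|n0] := posnP n.
  by exists 0 => gamma M _ _ _; rewrite {}n0 in M *; rewrite tuple0.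
have [C HC] := near_curve_size_le A n0 halpha hc0 hd heps.
exists C => gamma M Cg Ag _ _ _ Wc N N0 S.
(* Points outside [S] get time 0, as [choice] needs a total function. *)
have tex (p : R * R) : exists t : R, S p -> t \in `[0, 1] /\
    enorm (p - gamma t) < d / N%:R ^+ n.
  have [[[q [t t01 tq] pq] _]|nS] := pselect (S p); last by exists 0.
  by exists t => _; rewrite tq.
have [tm tmP] := choice tex.
apply: finite_set_of_uniq_seqs => s us sS.
apply: (HC gamma M Cg Ag Wc N tm s N0).
split=> // p /sS Sp; have [_ lp] := Sp; have [tp /ltW ep] := tmP p Sp.
split=> //; apply: le_trans ep.
- exact: (norm_fst_le_enorm (p - gamma (tm p))).
- exact: (norm_snd_le_enorm (p - gamma (tm p))).
Qed.
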